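(* Let $A\in\mathbb{R}^{m\times n}$ with $\mathrm{nnz}(A)\ge m+n$, let $\epsilon>0$ and let $\alpha\ge\epsilon/\log(2m)$. The randomized algorithm described in the context, run on $(A,\epsilon)$ with parameter $\alpha$, outputs a point $z=(z^{\mathsf x},z^{\mathsf y})\in\mathbb{B}^n\times\Delta^m$ such that $$\mathbb{E}\Big[\max_{y\in\Delta^m}y^\top A z^{\mathsf x}-\min_{x\in\mathbb{B}^n}(z^{\mathsf y})^\top A x\Big]=\mathbb{E}\Big[\max_i\,[Az^{\mathsf x}]_i+\|A^\top z^{\mathsf y}\|_2\Big]\le\epsilon,$$ and runs in time $$O\left(\left(\mathrm{nnz}(A)+\frac{(m+n)\|A\|_{2\to\infty}^2}{\alpha^2}\right)\frac{\alpha\log(2m)}{\epsilon}\right).$$ With the optimal setting of $\alpha$, the running time is $$O\left(\mathrm{nnz}(A)+\frac{\sqrt{\mathrm{nnz}(A)(m+n)}\,\|A\|_{2\to\infty}\log(2m)}{\epsilon}\right).$$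
   Context: Notation: $\Delta^m=\{v\in\mathbb{R}^m: v\ge 0,\ \|v\|_1=1\}$; $\mathbb{B}^n=\{v\in\mathbb{R}^n:\|v\|_2\le1\}$; $\mathrm{nnz}(A)$ is the number of nonzero entries of $A$; $A_{i:}$ and $A_{:j}$ are the $i$th row and $j$th column of $A$ (as vectors); $\|A\|_{2\to\infty}=\max_{i\in[m]}\|A_{i:}\|_2$; $[v]_i$ is the $i$th coordinate; for $z\in\mathbb{R}^n\times\mathbb{R}^m$, $z^{\mathsf x},z^{\mathsf y}$ are its first $n$ and last $m$ coordinates. Running time counts elementary operations (arithmetic, square root, $\exp$, $\log$, drawing a random number) at unit cost each; $\log$ and $\exp$ of vectors are coordinatewise. Algorithm (input $A$, $\epsilon$; parameter $\alpha$). Put $L=\|A\|_{2\to\infty}$, $K=\lceil\alpha\log(2m)/\epsilon\rceil$, $\eta=\alpha/(24L^2)$, $\tau=1/\eta$, $T=\lceil4/(\eta\alpha)\rceil$, $z_0=(\mathbf 0_n,\tfrac1m\mathbf 1_m)$, $\Pi_{\mathcal X}(v)=v/\max\{1,\|v\|_2\}$, $\Pi_{\mathcal Y}(v)=e^v/\|e^v\|_1$, and $[\mathsf T_\tau(v)]_k=\min\{\tau,\max\{-\tau,[v]_k\}\}$. For $k=1,\dots,K$: (1) Set $(x_0,y_0)=(z_{k-1}^{\mathsf x},z_{k-1}^{\mathsf y})$ and $g_0=(g_0^{\mathsf x},g_0^{\mathsf y})=(A^\top y_0,-Ax_0)$. (2) For $t=1,\dots,T$: sample independently (with fresh randomness)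 $i\sim p$ with $p_i=|[y_{t-1}]_i-[y_0]_i|/\|y_{t-1}-y_0\|_1$ and $j\sim q$ with $q_j=([x_{t-1}]_j-[x_0]_j)^2/\|x_{t-1}-x_0\|_2^2$; set $\tilde g_{t-1}=g_0+\big(A_{i:}\frac{[y_{t-1}]_i-[y_0]_i}{p_i},\,-\mathsf T_\tau\big(A_{:j}\frac{[x_{t-1}]_j-[x_0]_j}{q_j}\big)\big)$ (an increment is taken to be $0$ if the corresponding difference $y_{t-1}-y_0$ or $x_{t-1}-x_0$ is zero); set $x_t=\Pi_{\mathcal X}\big(\frac{1}{1+\eta\alpha/2}(x_{t-1}+\frac{\eta\alpha}{2}x_0-\eta\tilde g_{t-1}^{\mathsf x})\big)$ and $y_t=\Pi_{\mathcal Y}\big(\frac{1}{1+\eta\alpha/2}(\log y_{t-1}+\frac{\eta\alpha}{2}\log y_0-\eta\tilde g_{t-1}^{\mathsf y})\big)$. (3) Set $z_{k-1/2}=\frac1T\sum_{t=1}^T(x_t,y_t)$. (4) Set $z_k^{\mathsf x}=\Pi_{\mathcal X}(z_{k-1}^{\mathsf x}-\frac1\alpha A^\top z_{k-1/2}^{\mathsf y})$ and $z_k^{\mathsf y}=\Pi_{\mathcal Y}(\log z_{k-1}^{\mathsf y}+\frac1\alpha A z_{k-1/2}^{\mathsf x})$. Output: $\frac1K\sum_{k=1}^K z_{k-1/2}$. *)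

(* Defs.v *)
From mathcomp Require Export all_boot all_order all_algebra.
From mathcomp Require Export all_classical all_reals all_analysis.
Set Implicit Arguments.
Unset Strict Implicit.
Unset Printing Implicit Defensive.
Import Order.TTheory GRing.Theory Num.Theory.
Local Open Scope ring_scope.

(* [V] is the type of numbers held by the machine.  Programs are written
   polymorphically in [V], so a number can be created, combined or inspected
   only through the constructors below; each constructor other than [Ret] is
   one elementary operation.  Array indices and the sparsity pattern of the
   input are not numbers of the machine, and moving data is free. *)

Inductive unop := OSqrt | OExp | OLog.
Inductive binop := OAdd | OSub | OMul | ODiv.

Inductive prog (V B : Type) : Type :=
| Ret of B
| Lit of nat & (V -> prog V B)
| Op1 of unop & V & (V -> prog V B)
| Op2 of binop & V & V & (V -> prog V B)
| Less of V & V & (bool -> prog V B)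
| Ceil of V & (nat -> prog V B)
| Unif of (V -> prog V B). (* a fresh uniform random number in [0, 1) *)
Arguments Ret {V B}.

Fixpoint bind (V B B' : Type) (p : prog V B) (f : B -> prog V B') : prog V B' :=
  match p with
  | Ret b => f b
  | Lit k c => Lit k (fun v => bind (c v) f)
  | Op1 o x c => Op1 o x (fun v => bind (c v) f)
  | Op2 o x y c => Op2 o x y (fun v => bind (c v) f)
  | Less x y c => Less x y (fun b => bind (c b) f)
  | Ceil x c => Ceil x (fun k => bind (c k) f)
  | Unif c => Unif (fun v => bind (c v) f)
  end.

Notation "x <~ p ;; q" := (bind p (fun x => q))
  (at level 100, p at next level, q at level 200, right associativity,
   format "'[v' x  <~  p  ;; '/' q ']'").

Section Semantics.
Context {R : realType}.

Definition unop_sem (o : unop) (x : R) : R :=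
  match o with OSqrt => Num.sqrt x | OExp => expR x | OLog => ln x end.

Definition binop_sem (o : binop) (x y : R) : R :=
  match o with
  | OAdd => x + y | OSub => x - y | OMul => x * y | ODiv => x / y
  end.

Definition ceil_sem (x : R) : nat :=
  if Num.ceil x is Posz k then k else 0%N.

(* [w] is the stream of random numbers, consumed in order; the result is the
   output together with the number of operations performed. *)
Fixpoint exec (B : Type) (p : prog R B) (w : nat -> R) : B * nat :=
  let tick r := (r.1, r.2.+1) in
  match p with
  | Ret b => (b, 0%N)
  | Lit k c => tick (exec (c k%:R) w)
  | Op1 o x c => tick (exec (c (unop_sem o x)) w)
  | Op2 o x y c => tick (exec (c (binop_sem o x y)) w)
  | Less x y c => tick (exec (c (x < y)) w)
  | Ceil x c => tick (exec (c (ceil_sem x)) w)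
  | Unif c => tick (exec (c (w 0%N)) (fun k => w k.+1))
  end.

Definition output (B : Type) (p : prog R B) (w : nat -> R) : B := (exec p w).1.
Definition cost (B : Type) (p : prog R B) (w : nat -> R) : nat := (exec p w).2.

Definition random_stream (w : nat -> R) : Prop := forall k, 0 <= w k < 1.

(* [expect p f] is the expectation of [f (output p w)] for independent uniform
   [w k].  A run consumes finitely many of them, so this is an iterated
   integral. *)
Fixpoint expect (B : Type) (p : prog R B) (f : B -> \bar R) : \bar R :=
  match p with
  | Ret b => f b
  | Lit k c => expect (c k%:R) f
  | Op1 o x c => expect (c (unop_sem o x)) f
  | Op2 o x y c => expect (c (binop_sem o x y)) f
  | Less x y c => expect (c (x < y)) f
  | Ceil x c => expect (c (ceil_sem x)) f
  | Unif c => (\int[lebesgue_measure]_(u in `[0%R, 1%R[%classic) expect (c u) f)%E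
  end.

End Semantics.

(* The nonzero entries of an [m x n] matrix, listed by row and by column. *)
Record sparse (V : Type) (m n : nat) := Sparse {
  srow : 'I_m -> seq ('I_n * V);
  scol : 'I_n -> seq ('I_m * V) }.

Section Algorithm.
Context {V : Type}.

Definition lit k : prog V V := Lit k Ret.
Definition psqrt x : prog V V := Op1 OSqrt x Ret.
Definition pexp x : prog V V := Op1 OExp x Ret.
Definition plog x : prog V V := Op1 OLog x Ret.
Definition padd x y : prog V V := Op2 OAdd x y Ret.
Definition psub x y : prog V V := Op2 OSub x y Ret.
Definition pmul x y : prog V V := Op2 OMul x y Ret.
Definition pdiv x y : prog V V := Op2 ODiv x y Ret.
Definition pless x y : prog V bool := Less x y Ret.
Definition pceil x : prog V nat := Ceil x Ret.
Definition puniform : prog V V := Unif Ret.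

Definition pneg x : prog V V := z <~ lit 0;; psub z x.
Definition psqr x : prog V V := pmul x x.
Definition pmax x y : prog V V := b <~ pless x y;; Ret (if b then y else x).
Definition pmin x y : prog V V := b <~ pless x y;; Ret (if b then x else y).
Definition pabs x : prog V V := y <~ pneg x;; pmax x y.

Fixpoint iterp (S : Type) (k : nat) (body : S -> prog V S) (s : S) : prog V S :=
  if k is k'.+1 then s' <~ body s;; iterp k' body s' else Ret s.

Fixpoint tabulate n : ('I_n -> prog V V) -> prog V ('I_n -> V) :=
  if n is n'.+1 return ('I_n -> prog V V) -> prog V ('I_n -> V) then fun f =>
    v <~ f ord0;;
    g <~ tabulate (fun i => f (lift ord0 i));;
    Ret (fun i => if unlift ord0 i is Some j then g j else v)
  else fun _ => Ret (fun i : 'I_0 => match notF (ltn_ord i) with end).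

Definition vec n (f : 'I_n -> prog V V) : prog V 'cV[V]_n :=
  g <~ tabulate f;; Ret (\col_i g i).

Fixpoint psum (s : seq V) : prog V V :=
  if s is x :: s' then t <~ psum s';; padd x t else lit 0.

Fixpoint pmaxs (s : seq V) : prog V V :=
  if s is x :: s' then t <~ pmaxs s';; pmax x t else lit 0.

Definition entries n (x : 'cV[V]_n) : seq V := [seq x i ord0 | i <- enum 'I_n].

Definition vmap n (f : V -> prog V V) (x : 'cV[V]_n) := vec (fun i => f (x i ord0)).
Definition vmap2 n (f : V -> V -> prog V V) (x y : 'cV[V]_n) :=
  vec (fun i => f (x i ord0) (y i ord0)).
Definition vadd n := @vmap2 n padd.
Definition vsub n := @vmap2 n psub.
Definition vneg n := @vmap n pneg.
Definition vscale n (c : V) := @vmap n (pmul c).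

Definition vnorm1 n (x : 'cV[V]_n) : prog V V :=
  a <~ vmap pabs x;; psum (entries a).
Definition vnorm2 n (x : 'cV[V]_n) : prog V V :=
  a <~ vmap psqr x;; s <~ psum (entries a);; psqrt s.

Fixpoint sdot n (s : seq ('I_n * V)) (x : 'cV[V]_n) : prog V V :=
  if s is (j, a) :: s' then
    t <~ sdot s' x;; u <~ pmul a (x j ord0);; padd u t
  else lit 0.

Fixpoint ssqr n (s : seq ('I_n * V)) : prog V V :=
  if s is (_, a) :: s' then t <~ ssqr s';; u <~ psqr a;; padd u t else lit 0.

Definition snorm2 n (s : seq ('I_n * V)) : prog V V := t <~ ssqr s;; psqrt t.

Definition densify n (zero : V) (s : seq ('I_n * V)) : 'cV[V]_n :=
  \col_k foldr (fun ja v => if k == ja.1 then ja.2 else v) zero s.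

Definition mulv m n (A : sparse V m n) (x : 'cV[V]_n) : prog V 'cV[V]_m :=
  vec (fun i => sdot (srow A i) x).
Definition mulTv m n (A : sparse V m n) (y : 'cV[V]_m) : prog V 'cV[V]_n :=
  vec (fun j => sdot (scol A j) y).

Definition norm2inf m n (A : sparse V m n) : prog V V :=
  r <~ vec (fun i => snorm2 (srow A i));; pmaxs (entries r).

Definition projX n (v : 'cV[V]_n) : prog V 'cV[V]_n :=
  r <~ vnorm2 v;; one <~ lit 1;; d <~ pmax one r;;
  vmap (fun a => pdiv a d) v.

Definition projY m (v : 'cV[V]_m) : prog V 'cV[V]_m :=
  e <~ vmap pexp v;; s <~ vnorm1 e;; vmap (fun a => pdiv a s) e.

Definition clip m (tau : V) (v : 'cV[V]_m) : prog V 'cV[V]_m :=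
  ntau <~ pneg tau;;
  vmap (fun a => b <~ pmax ntau a;; pmin tau b) v.

(* Sampling from the distribution [p] by inversion of its cumulative sums.
   [None] would require the total mass to be at most the random number, which
   does not happen when [p] sums to 1. *)
Fixpoint invert n (p : 'cV[V]_n) (u acc : V) (s : seq 'I_n) :
    prog V (option 'I_n) :=
  if s is i :: s' then
    acc' <~ padd acc (p i ord0);; b <~ pless u acc';;
    if b then Ret (Some i) else invert p u acc' s'
  else Ret None.

Definition sample n (p : 'cV[V]_n) : prog V (option 'I_n) :=
  u <~ puniform;; zero <~ lit 0;; invert p u zero (enum 'I_n).

(* A_{i:} ([y]_i - [y0]_i) / p_i *)
Definition incX m n (A : sparse V m n) (y y0 : 'cV[V]_m) : prog V 'cV[V]_n :=
  d <~ vsub y y0;; s <~ vnorm1 d;; zero <~ lit 0;; b <~ pless zero s;;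
  if b then
    p <~ vmap (fun a => a' <~ pabs a;; pdiv a' s) d;;
    oi <~ sample p;;
    if oi is Some i then
      c <~ pdiv (d i ord0) (p i ord0);; vscale c (densify zero (srow A i))
    else Ret (const_mx zero)
  else Ret (const_mx zero).

(* - T_tau (A_{:j} ([x]_j - [x0]_j) / q_j) *)
Definition incY m n (A : sparse V m n) (tau : V) (x x0 : 'cV[V]_n) :
    prog V 'cV[V]_m :=
  d <~ vsub x x0;; s <~ vnorm2 d;; zero <~ lit 0;; b <~ pless zero s;;
  if b then
    s2 <~ psqr s;;
    q <~ vmap (fun a => a2 <~ psqr a;; pdiv a2 s2) d;;
    oj <~ sample q;;
    if oj is Some j then
      c <~ pdiv (d j ord0) (q j ord0);;
      v <~ vscale c (densify zero (scol A j));;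
      w <~ clip tau v;; vneg w
    else Ret (const_mx zero)
  else Ret (const_mx zero).

(* w (u + h u0 - eta g) *)
Definition combine n (w h eta : V) (u u0 g : 'cV[V]_n) : prog V 'cV[V]_n :=
  a <~ vscale h u0;; b <~ vadd u a;; c <~ vscale eta g;; d <~ vsub b c;;
  vscale w d.

Definition point m n := ('cV[V]_n * 'cV[V]_m)%type.

(* One iteration of the inner loop, on the current iterate and the sum of the
   iterates so far; [h] is eta alpha / 2 and [w] is 1 / (1 + h). *)
Definition inner_step m n (A : sparse V m n) (tau eta h w : V)
    (z0 g0 : point m n) (s : point m n * point m n) :
    prog V (point m n * point m n) :=
  let: (x0, y0) := z0 in let: (g0x, g0y) := g0 in
  let: ((x, y), (sx, sy)) := s in
  dx <~ incX A y y0;; dy <~ incY A tau x x0;;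
  gx <~ vadd g0x dx;; gy <~ vadd g0y dy;;
  vx <~ combine w h eta x x0 gx;; x' <~ projX vx;;
  ly <~ vmap plog y;; ly0 <~ vmap plog y0;;
  vy <~ combine w h eta ly ly0 gy;; y' <~ projY vy;;
  sx' <~ vadd sx x';; sy' <~ vadd sy y';;
  Ret ((x', y'), (sx', sy')).

(* Iteration k of the outer loop, on z_{k-1} and the sum of the z_{k'-1/2} for k' < k. *)
Definition outer_step m n (A : sparse V m n) (T : nat) (alpha tau eta h w : V)
    (s : point m n * point m n) : prog V (point m n * point m n) :=
  let: ((x0, y0), (Sx, Sy)) := s in
  g0x <~ mulTv A y0;; Ax0 <~ mulv A x0;; g0y <~ vneg Ax0;;
  zero <~ lit 0;;
  r <~ iterp T (inner_step A tau eta h w (x0, y0) (g0x, g0y))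
         ((x0, y0), (const_mx zero, const_mx zero));;
  T' <~ lit T;;
  hx <~ vmap (fun a => pdiv a T') r.2.1;;
  hy <~ vmap (fun a => pdiv a T') r.2.2;;
  one <~ lit 1;; ialpha <~ pdiv one alpha;;
  ATy <~ mulTv A hy;; bx <~ vscale ialpha ATy;; vx <~ vsub x0 bx;; x' <~ projX vx;;
  ly0 <~ vmap plog y0;;
  Ax <~ mulv A hx;; b_y <~ vscale ialpha Ax;; vy <~ vadd ly0 b_y;; y' <~ projY vy;;
  Sx' <~ vadd Sx hx;; Sy' <~ vadd Sy hy;;
  Ret ((x', y'), (Sx', Sy')).

Definition solve m n (A : sparse V m n) (eps alpha : V) : prog V (point m n) :=
  zero <~ lit 0;; one <~ lit 1;; two <~ lit 2;; four <~ lit 4;;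
  c24 <~ lit 24;; m' <~ lit m;;
  L <~ norm2inf A;;
  (* K = ceil (alpha log (2m) / eps) *)
  m2 <~ pmul two m';; lm <~ plog m2;; a <~ pmul alpha lm;;
  b <~ pdiv a eps;; K <~ pceil b;;
  (* eta = alpha / (24 L^2), tau = 1 / eta *)
  L2 <~ psqr L;; c <~ pmul c24 L2;; eta <~ pdiv alpha c;;
  tau <~ pdiv one eta;;
  (* T = ceil (4 / (eta alpha)) *)
  ea <~ pmul eta alpha;; d <~ pdiv four ea;; T <~ pceil d;;
  h <~ pdiv ea two;; e <~ padd one h;; w <~ pdiv one e;;
  im <~ pdiv one m';;
  r <~ iterp K (outer_step A T alpha tau eta h w)
         ((const_mx zero, const_mx im), (const_mx zero, const_mx zero));;
  K' <~ lit K;;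
  zx <~ vmap (fun a => pdiv a K') r.2.1;;
  zy <~ vmap (fun a => pdiv a K') r.2.2;;
  Ret (zx, zy).

End Algorithm.

Section Problem.
Context {R : realType}.

Definition nnz m n (A : 'M[R]_(m, n)) : nat :=
  #|[set ij : 'I_m * 'I_n | A ij.1 ij.2 != 0%R]|.

Definition sparse_of m n (A : 'M[R]_(m, n)) : sparse R m n :=
  Sparse (fun i => [seq (j, A i j) | j <- enum 'I_n & A i j != 0])
         (fun j => [seq (i, A i j) | i <- enum 'I_m & A i j != 0]).

Definition l1norm n (v : 'cV[R]_n) : R := \sum_i `|v i ord0|.
Definition l2norm n (v : 'cV[R]_n) : R := Num.sqrt (\sum_i v i ord0 ^+ 2).
Definition l2inf_norm m n (A : 'M[R]_(m, n)) : R :=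
  \big[Num.max/0]_i l2norm (row i A)^T.

Definition simplex m : set 'cV[R]_m :=
  [set v : 'cV[R]_m | (forall i, 0 <= v i ord0) /\ l1norm v = 1]%classic.
Definition l2ball n : set 'cV[R]_n := [set v : 'cV[R]_n | l2norm v <= 1]%classic.

Definition bilin m n (A : 'M[R]_(m, n)) (y : 'cV[R]_m) (x : 'cV[R]_n) : R :=
  (y^T *m A *m x) ord0 ord0.

(* [sup] and [inf] are attained: the bilinear form is continuous and both
   domains are nonempty (for 0 < m) and compact. *)
Definition duality_gap m n (A : 'M[R]_(m, n)) (z : 'cV[R]_n * 'cV[R]_m) : R :=
  sup [set bilin A y z.1 | y in @simplex m]%classic
  - inf [set bilin A z.2 x | x in @l2ball n]%classic.

Definition explicit_gap m n (A : 'M[R]_(m, n)) (z : 'cV[R]_n * 'cV[R]_m) : R :=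
  sup (range (fun i => (A *m z.1) i ord0)) + l2norm (A^T *m z.2).

Definition time_bound m n (A : 'M[R]_(m, n)) (eps alpha : R) : R :=
  ((nnz A)%:R + (m + n)%:R * l2inf_norm A ^+ 2 / alpha ^+ 2)
  * (alpha * ln (2 * m)%:R / eps).

Definition admissible m (eps alpha : R) : Prop := eps / ln (2 * m)%:R <= alpha.

Definition optimal m n (A : 'M[R]_(m, n)) (eps alpha : R) : Prop :=
  admissible m eps alpha /\
  forall beta, admissible m eps beta ->
    time_bound A eps alpha <= time_bound A eps beta.

End Problem.

(* Main.v *)
Require Import Defs.
From mathcomp Require Import ring lra zify measurable_realfun.
Import Order.TTheory GRing.Theory Num.Theory.
Local Open Scope classical_set_scope.
Local Open Scope ring_scope.
Set Implicit Arguments.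
Unset Strict Implicit.
Unset Printing Implicit Defensive.

(* With g(z) = (A^T z^y, - A z^x) and V the sum of half the squared distance and
   the relative entropy, the mirror steps (4) telescope once every inner loop
   satisfies E max_u [<g(z'), z' - u> - alpha V_z(u)] <= 0 for its average z'.
   To keep the maximum inside the expectation, the centred noise D of a sampled
   gradient at w is split as <D, w - u> = <D, w - s> + <D, s - u>, where the ghost
   iterates s run mirror descent on D itself: the first term has mean zero and the
   second is bounded by the regret of s, uniformly in u.  The variances and the
   clipping bias are multiples of eta L^2 V_z(w) and are absorbed by the
   regularisation term - (alpha / 2) V_z(w).  Gradients are sampled at w_(t-1) while
   w_t is averaged; since <g(w), w> = 0 this shift telescopes to a single cross
   term, paid by V_(w_T)(u) and V_z(w_T).
   No maximum over u is ever formed: the induction transports the statement that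
   a potential is at most c for all u.  A random number influences a run only
   through the index selected by inversion, so all integrals are finite sums. *)

(** * Semantics of programs *)

Section Programs.
Context {R : realType}.

(** The constants come from one budget. In units of (eta L)^2, a step from w costs on average at
    most 4 KL(w^y, z^y) for the sampled row and 21/4 |w^x - z^x|^2 for the sampled column, plus 1/2
    |w^x - z^x|^2 for the clipping bias. The regularisation pays h V_z(w) with h = eta alpha / 2,
    and V_z(w) contains only half the squared distance, so h has to be at least 23/2 (eta L)^2; eta
    = alpha / (24 L^2) makes it 12 (eta L)^2. The threshold tau = 1 / eta keeps eta times a clipped
    entry in [-1, 1], where exp is bounded by a quadratic. Rows enter through the Euclidean norm,
    for which no such range is required, and are not clipped. Real and ghost iterates both start at
    z, so the analysis owes 2 V_z(u). Of the total 2 h T V_z(u) granted by alpha, half is spent step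
    by step on the proximal terms and the other half must cover this debt: h T >= 2, that is T >= 4
    / (eta alpha). *)

Lemma expect_bind (B B' : Type) (p : prog R B) (k : B -> prog R B') f :
  expect (bind p k) f = expect p (fun b => expect (k b) f).
Proof.
elim: p => [b|n c IH|o x c IH|o x y c IH|x y c IH|x c IH|c IH] //=.
by apply: eq_integral => u _; exact: IH.
Qed.

(** [w'] is the unread remainder of the stream. It can stay existential because [always] and
    [cost_le] quantify over all streams. *)
Lemma exec_bind (B B' : Type) (p : prog R B) (k : B -> prog R B') w :
  exists w', output (bind p k) w = output (k (output p w)) w' /\
    cost (bind p k) w = (cost p w + cost (k (output p w)) w')%N.
Proof.
elim: p w => [b|n c IH|o x c IH|o x y c IH|x y c IH|x c IH|c IH] w.
- by exists w.
- by have [w' [E1 E2]] := IH n%:R w; exists w'; rewrite -E1 /cost /= -!/(cost _ _) E2.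
- by have [w' [E1 E2]] := IH (unop_sem o x) w; exists w'; rewrite -E1 /cost /= -!/(cost _ _) E2.
- by have [w' [E1 E2]] := IH (binop_sem o x y) w; exists w'; rewrite -E1 /cost /= -!/(cost _ _) E2.
- by have [w' [E1 E2]] := IH (x < y) w; exists w'; rewrite -E1 /cost /= -!/(cost _ _) E2.
- by have [w' [E1 E2]] := IH (ceil_sem x) w; exists w'; rewrite -E1 /cost /= -!/(cost _ _) E2.
- by have [w' [E1 E2]] := IH (w 0%N) (fun k => w k.+1); exists w'; rewrite -E1 /cost /= -!/(cost _ _) E2.
Qed.

(** Deterministic subprograms get both readings at once, so each subroutine is analysed a single
    time, for runs and for expectations. *)
Definition evals (B : Type) (p : prog R B) (b : B) : Prop :=
  (forall w, output p w = b) /\ (forall f, expect p f = f b).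

(** All streams are allowed, even outside [0, 1): feasibility of the output and operation counts
    hold whatever numbers are drawn. *)
Definition always (B : Type) (p : prog R B) (Q : B -> Prop) : Prop :=
  forall w, Q (output p w).

Definition cost_le (B : Type) (p : prog R B) (n : nat) : Prop :=
  forall w, (cost p w <= n)%N.

Lemma evals_bind B B' (p : prog R B) b (k : B -> prog R B') b' :
  evals p b -> evals (k b) b' -> evals (bind p k) b'.
Proof.
move=> [po pe] [ko ke]; split=> [w|f]; last by rewrite expect_bind pe ke.
by have [w' [-> _]] := exec_bind p k w; rewrite po ko.
Qed.

Lemma always_ret B (b : B) (Q : B -> Prop) : Q b -> always (Ret b) Q.
Proof. by move=> Qb w. Qed.

Lemma always_bind B B' (P : B -> Prop) (Q : B' -> Prop) (p : prog R B)
    (k : B -> prog R B') :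
  always p P -> (forall b, P b -> always (k b) Q) -> always (bind p k) Q.
Proof.
by move=> pP kQ w; have [w' [-> _]] := exec_bind p k w; apply: kQ; exact: pP.
Qed.

Lemma always_evals B B' (Q : B' -> Prop) (p : prog R B) b (k : B -> prog R B') :
  evals p b -> always (k b) Q -> always (bind p k) Q.
Proof.
move=> [pb _] kQ; apply: (@always_bind _ _ (fun b' => b' = b)) => // b' -> //.
Qed.

Lemma always_true B (p : prog R B) : always p (fun=> True).
Proof. by []. Qed.

Lemma expect_evals B B' (p : prog R B) b (k : B -> prog R B') f :
  evals p b -> expect (bind p k) f = expect (k b) f.
Proof. by move=> [_ pe]; rewrite expect_bind pe. Qed.

Lemma cost_leW B (p : prog R B) a b : cost_le p a -> (a <= b)%N -> cost_le p b.
Proof. by move=> pa ab w; exact: leq_trans (pa w) ab. Qed.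

Lemma cost_ret B (b : B) n : cost_le (Ret b) n. Proof. by []. Qed.

Lemma cost_bind B B' (p : prog R B) (k : B -> prog R B') a c :
  cost_le p a -> (forall b, cost_le (k b) c) -> cost_le (bind p k) (a + c).
Proof.
move=> pa kc w; have [w' [_ ->]] := exec_bind p k w.
by apply: leq_add; [exact: pa|exact: kc].
Qed.

(** Unlike [cost_bind], this remembers the value of [p]: the loop counts K and T are computed by the
    program, and the cost of the rest depends on them. *)
Lemma cost_evals B B' (p : prog R B) b (k : B -> prog R B') a c :
  evals p b -> cost_le p a -> cost_le (k b) c -> cost_le (bind p k) (a + c).
Proof.
move=> [pb _] pa kc w; have [w' [_ ->]] := exec_bind p k w.
by apply: leq_add; [exact: pa|rewrite pb; exact: kc].
Qed.

Lemma always_iterp S (I : nat -> S -> Prop) (body : S -> prog R S) k t s :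
  (forall t s, I t s -> always (body s) (I t.+1)) ->
  I t s -> always (iterp k body s) (I (k + t)%N).
Proof.
move=> H; elim: k t s => [|k IH] t s Is; first exact: always_ret.
by apply: always_bind (H _ _ Is) _ => b /IH; rewrite addnS.
Qed.

Lemma cost_iterp S (body : S -> prog R S) k s c :
  (forall s, cost_le (body s) c) -> cost_le (iterp k body s) (k * c)%N.
Proof.
move=> H; elim: k s => [|k IH] s; first exact: cost_ret.
by rewrite mulSn; exact: cost_bind (H _) IH.
Qed.

(** * Values of the deterministic subroutines *)

Lemma evals_lit k : evals (lit k) (k%:R : R). Proof. by []. Qed.
Lemma evals_sqrt (x : R) : evals (psqrt x) (Num.sqrt x). Proof. by []. Qed.
Lemma evals_exp (x : R) : evals (pexp x) (expR x). Proof. by []. Qed.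
Lemma evals_log (x : R) : evals (plog x) (ln x). Proof. by []. Qed.
Lemma evals_add (x y : R) : evals (padd x y) (x + y). Proof. by []. Qed.
Lemma evals_sub (x y : R) : evals (psub x y) (x - y). Proof. by []. Qed.
Lemma evals_mul (x y : R) : evals (pmul x y) (x * y). Proof. by []. Qed.
Lemma evals_div (x y : R) : evals (pdiv x y) (x / y). Proof. by []. Qed.
Lemma evals_less (x y : R) : evals (pless x y) (x < y). Proof. by []. Qed.
Lemma evals_ceil (x : R) : evals (pceil x) (ceil_sem x). Proof. by []. Qed.

Lemma evals_neg (x : R) : evals (pneg x) (- x).
Proof. by split=> [w|f]; rewrite /output /= sub0r. Qed.
Lemma evals_sqr (x : R) : evals (psqr x) (x ^+ 2).
Proof. by split=> [w|f]; rewrite /output /= expr2. Qed.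
Lemma evals_max (x y : R) : evals (pmax x y) (Num.max x y).
Proof. by split=> [w|f]; rewrite /output /= maxElt. Qed.
Lemma evals_min (x y : R) : evals (pmin x y) (Num.min x y).
Proof. by split=> [w|f]; rewrite /output /= minElt. Qed.
Lemma evals_abs (x : R) : evals (pabs x) `|x|.
Proof.
apply: evals_bind (evals_neg x) _.
have -> : `|x| = Num.max x (- x); last exact: evals_max.
by case: (lerP 0 x) => x0; [rewrite ger0_norm// max_l//; lra
                         | rewrite ltr0_norm// max_r//; lra].
Qed.

Lemma evals_tabulate n (f : 'I_n -> prog R R) g :
  (forall i, evals (f i) (g i)) -> evals (tabulate f) g.
Proof.
elim: n f g => [|n IH] f g fg /=.
  by rewrite (_ : g = (fun i : 'I_0 => match notF (ltn_ord i) with end))//;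
    apply/funext => -[].
apply: evals_bind (fg ord0) _.
apply: evals_bind (IH _ (fun i => g (lift ord0 i)) _) _ => [i|]; first exact: fg.
rewrite [X in evals _ X](_ : g =
  (fun i => if unlift ord0 i is Some j then g (lift ord0 j) else g ord0))//.
by apply/funext => i; case: unliftP => [j ->|->].
Qed.

Lemma evals_vec n (f : 'I_n -> prog R R) g :
  (forall i, evals (f i) (g i)) -> evals (vec f) (\col_i g i).
Proof. by move=> fg; apply: evals_bind (evals_tabulate fg) _. Qed.

Lemma evals_vmap n (f : R -> prog R R) g (x : 'cV[R]_n) :
  (forall a, evals (f a) (g a)) -> evals (vmap f x) (\col_i g (x i ord0)).
Proof. by move=> fg; apply: evals_vec. Qed.

Lemma evals_vmap2 n (f : R -> R -> prog R R) g (x y : 'cV[R]_n) :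
  (forall a b, evals (f a b) (g a b)) ->
  evals (vmap2 f x y) (\col_i g (x i ord0) (y i ord0)).
Proof. by move=> fg; apply: evals_vec. Qed.

Lemma evals_eq B (p : prog R B) b b' : evals p b -> b = b' -> evals p b'.
Proof. by move=> ? <-. Qed.

Lemma evals_vadd n (x y : 'cV[R]_n) : evals (vadd x y) (x + y).
Proof.
apply: evals_eq (evals_vmap2 x y evals_add) _.
by apply/colP => i; rewrite !mxE.
Qed.

Lemma evals_vsub n (x y : 'cV[R]_n) : evals (vsub x y) (x - y).
Proof.
apply: evals_eq (evals_vmap2 x y evals_sub) _.
by apply/colP => i; rewrite !mxE.
Qed.

Lemma evals_vneg n (x : 'cV[R]_n) : evals (vneg x) (- x).
Proof.
apply: evals_eq (evals_vmap x evals_neg) _.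
by apply/colP => i; rewrite !mxE.
Qed.

Lemma evals_vscale n c (x : 'cV[R]_n) : evals (vscale c x) (c *: x).
Proof.
apply: evals_eq (evals_vmap x (evals_mul c)) _.
by apply/colP => i; rewrite !mxE.
Qed.

Lemma evals_vdiv n c (x : 'cV[R]_n) :
  evals (vmap (fun a => pdiv a c) x) (c^-1 *: x).
Proof.
apply: evals_eq (evals_vmap x (fun a => evals_div a c)) _.
by apply/colP => i; rewrite !mxE mulrC.
Qed.

Lemma evals_psum (s : seq R) : evals (psum s) (\sum_(x <- s) x).
Proof.
elim: s => [|x s IH] /=; first by rewrite big_nil; exact: evals_lit.
by rewrite big_cons; apply: evals_bind IH _; exact: evals_add.
Qed.

Lemma evals_pmaxs (s : seq R) : evals (pmaxs s) (\big[Num.max/0]_(x <- s) x).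
Proof.
elim: s => [|x s IH] /=; first by rewrite big_nil; exact: evals_lit.
by rewrite big_cons; apply: evals_bind IH _; exact: evals_max.
Qed.

Lemma evals_vnorm1 n (x : 'cV[R]_n) : evals (vnorm1 x) (l1norm x).
Proof.
apply: evals_bind (evals_vmap x evals_abs) _.
apply: evals_eq (evals_psum _) _.
by rewrite /entries big_map big_enum /=; apply: eq_bigr => i _; rewrite mxE.
Qed.

Lemma evals_vnorm2 n (x : 'cV[R]_n) : evals (vnorm2 x) (l2norm x).
Proof.
apply: evals_bind (evals_vmap x evals_sqr) _.
apply: evals_bind (evals_psum _) _.
apply: evals_eq (evals_sqrt _) _; congr Num.sqrt.
by rewrite /entries big_map big_enum /=; apply: eq_bigr => i _; rewrite mxE.
Qed.

Lemma evals_sdot n (s : seq ('I_n * R)) x :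
  evals (sdot s x) (\sum_(ja <- s) ja.2 * x ja.1 ord0).
Proof.
elim: s => [|[j a] s IH] /=; first by rewrite big_nil; exact: evals_lit.
rewrite big_cons; apply: evals_bind IH _.
by apply: evals_bind (evals_mul _ _) _; exact: evals_add.
Qed.

Lemma evals_snorm2 n (s : seq ('I_n * R)) :
  evals (snorm2 s) (Num.sqrt (\sum_(ja <- s) ja.2 ^+ 2)).
Proof.
rewrite /snorm2; suff H : evals (ssqr s) (\sum_(ja <- s) ja.2 ^+ 2).
  by apply: evals_bind H _; exact: evals_sqrt.
elim: s => [|[j a] s IH] /=; first by rewrite big_nil; exact: evals_lit.
rewrite big_cons; apply: evals_bind IH _.
by apply: evals_bind (evals_sqr _) _; exact: evals_add.
Qed.

Lemma foldr_nonzero n (f : 'I_n -> R) k s :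
  foldr (fun ja v => if k == ja.1 then ja.2 else v) 0
    [seq (j, f j) | j <- s & f j != 0] = if k \in s then f k else 0.
Proof.
elim: s => //= j s IH; rewrite inE; case: (eqVneq k j) => [<-|kj] /=.
  by case: (eqVneq (f k) 0) => [fk0|] /=; rewrite ?eqxx// IH fk0 if_same.
by case: ifP => //=; rewrite (negbTE kj).
Qed.

Section SparseMatrix.
Context (m n : nat) (A : 'M[R]_(m, n)).

Lemma sum_srow i (F : 'I_n -> R -> R) : (forall j, F j 0 = 0) ->
  \sum_(ja <- srow (sparse_of A) i) F ja.1 ja.2 = \sum_j F j (A i j).
Proof.
move=> F0; rewrite /= big_map big_filter big_enum_cond /=.
rewrite [RHS](bigID (fun j => A i j != 0)) /= [X in _ + X]big1 ?addr0//.
by move=> j /negPn /eqP ->.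
Qed.

Lemma sum_scol j (F : 'I_m -> R -> R) : (forall i, F i 0 = 0) ->
  \sum_(ia <- scol (sparse_of A) j) F ia.1 ia.2 = \sum_i F i (A i j).
Proof.
move=> F0; rewrite /= big_map big_filter big_enum_cond /=.
rewrite [RHS](bigID (fun i => A i j != 0)) /= [X in _ + X]big1 ?addr0//.
by move=> i /negPn /eqP ->.
Qed.

Lemma evals_mulv x : evals (mulv (sparse_of A) x) (A *m x).
Proof.
apply: evals_eq (evals_vec _) _; first by move=> i; exact: evals_sdot.
apply/colP => i; rewrite !mxE (sum_srow i (F := fun j a => a * x j ord0))//.
by move=> j; rewrite mul0r.
Qed.

Lemma evals_mulTv y : evals (mulTv (sparse_of A) y) (A^T *m y).
Proof.
apply: evals_eq (evals_vec _) _; first by move=> i; exact: evals_sdot.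
apply/colP => j; rewrite !mxE (sum_scol j (F := fun i a => a * y i ord0))//.
  by apply: eq_bigr => i _; rewrite mxE.
by move=> i; rewrite mul0r.
Qed.

Lemma evals_norm2inf : evals (norm2inf (sparse_of A)) (l2inf_norm A).
Proof.
apply: evals_bind; first by apply: evals_vec => i; exact: evals_snorm2.
apply: evals_eq (evals_pmaxs _) _.
rewrite /entries big_map big_enum /=; apply: eq_bigr => i _.
rewrite mxE /l2norm; congr Num.sqrt.
rewrite (sum_srow i (F := fun j a => a ^+ 2)) ?expr0n//.
by apply: eq_bigr => j _; rewrite !mxE.
Qed.

Lemma densify_srow i : densify 0 (srow (sparse_of A) i) = (row i A)^T.
Proof. by apply/colP => k; rewrite !mxE /= foldr_nonzero mem_enum. Qed.

Lemma densify_scol j : densify 0 (scol (sparse_of A) j) = col j A.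
Proof. by apply/colP => k; rewrite !mxE /= (foldr_nonzero (A^~ j)) mem_enum. Qed.

End SparseMatrix.

(* Finiteness is part of the bound because integrals of functions with infinite
   values are not additive. *)
Definition fle (e : \bar R) (c : R) : Prop := exists2 r, e = r%:E & r <= c.

Lemma fleW e c c' : fle e c -> c <= c' -> fle e c'.
Proof. by move=> [r -> rc] cc'; exists r => //; exact: le_trans cc'. Qed.

(** Inversion returns the head of the list exactly for u in [acc, acc + p_i) and recurses on the
    rest of the interval. Measurability is carried through the induction because it is what allows
    the integral to be split there. *)
Lemma expect_invert n (p : 'cV[R]_n) (h : option 'I_n -> \bar R)
    (r : 'I_n -> R) (s : seq 'I_n) acc :
  (forall i, 0 <= p i ord0) -> acc + \sum_(i <- s) p i ord0 = 1 ->
  (forall i, h (Some i) = (r i)%:E) ->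
  let G (u : R) := expect (invert p u acc s) h in
  measurable_fun `[acc, 1[ G /\
  (\int[lebesgue_measure]_(u in `[acc, 1%R[) G u =
    (\sum_(i <- s) p i ord0 * r i)%R%:E)%E.
Proof.
move=> p0 + hr; elim: s acc => [|i s IH] acc /=.
  (* With the mass exhausted, acc = 1 and the interval is empty, so the outcome [None] is never
     integrated. *)
  rewrite !big_nil addr0 => ->; rewrite set_itvco0.
  by split; [exact: measurable_fun_set0|rewrite integral_set0].
rewrite !big_cons addrA => sum1.
set a := acc + p i ord0 in sum1 *.
have acca : acc <= a by rewrite lerDl.
have a1 : a <= 1 by rewrite -sum1 lerDl sumr_ge0.
have [mG IG] := IH a sum1.
have -> : `[acc, 1[%classic = `[acc, a[%classic `|` `[a, 1[%classic :> set R.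
  by apply/seteqP; split=> x /=; rewrite !in_itv /=;
    [case: (ltP x a) => xa /andP[-> ->]; [left|right]
    | case=> /andP[l u]; rewrite ?l ?u ?(lt_le_trans u a1) ?(le_trans acca l)].
pose G (u : R) := expect (if u < a then Ret (Some i) else invert p u a s) h.
rewrite -/G.
have G1 : {in `[acc, a[%classic, G =1 cst (r i)%:E}.
  by move=> u; rewrite inE /= in_itv /= => /andP[_ ua]; rewrite /G ua /= hr.
have G2 : {in `[a, 1[%classic, G =1 fun u => expect (invert p u a s) h}.
  move=> u; rewrite inE /= in_itv /= => /andP[au _].
  by rewrite /G ltNge au.
have mG1 : measurable_fun `[acc, a[ G.
  by apply: (eq_measurable_fun (cst (r i)%:E)) => [u /G1 -> //|]; exact: measurable_cst.
have mG2 : measurable_fun `[a, 1[ G.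
  by apply: (eq_measurable_fun (fun u => expect (invert p u a s) h)) => // u /G2 ->.
have mU : measurable_fun (`[acc, a[ `|` `[a, 1[) G.
  by apply/measurable_funU => //; split.
split=> //; rewrite integral_setU//=; last first.
  apply/disj_setPLR => x /=; rewrite !in_itv /= => /andP[_ xa].
  by apply/negP; rewrite negb_and -ltNge xa.
have I1 : (\int[lebesgue_measure]_(x in `[acc, a[) G x = (p i ord0 * r i)%R%:E)%E.
  have -> : (\int[lebesgue_measure]_(x in `[acc, a[) G x =
      \int[lebesgue_measure]_(x in `[acc, a[) cst (r i)%:E x)%E.
    by apply: eq_integral; exact: G1.
  rewrite integral_cst//=.
  rewrite [X in (_ * X)%E]lebesgue_measure_itv /= lte_fin.
  case: ltP => [_|aacc].
    by rewrite -EFinB -EFinM /a addrAC subrr add0r mulrC.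
  have -> : p i ord0 = 0 by apply/eqP; rewrite eq_le p0 andbT -(lerD2l acc) addr0.
  by rewrite mule0 mul0r.
have I2 : (\int[lebesgue_measure]_(x in `[a, 1%R[) G x =
    (\sum_(j <- s) p j ord0 * r j)%R%:E)%E.
  by rewrite -IG; apply: eq_integral; exact: G2.
by rewrite EFinD; exact: (congr2 adde I1 I2).
Qed.

(** Only upper bounds on the integrand are known, so its finite values are first named by choice and
    integrated exactly. No bound on [h None] is asked for, since with total mass 1 inversion
    succeeds on all of [0, 1). *)
Lemma expect_sample n (p : 'cV[R]_n) (h : option 'I_n -> \bar R) (c : 'I_n -> R) :
  (forall i, 0 <= p i ord0) -> \sum_i p i ord0 = 1 ->
  (forall i, fle (h (Some i)) (c i)) ->
  fle (expect (sample p) h) (\sum_i p i ord0 * c i).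
Proof.
move=> p0 p1 hc; have /choice[r hr] : forall i, exists r, h (Some i) = r%:E /\ r <= c i.
  by move=> i; have [r ? ?] := hc i; exists r.
exists (\sum_i p i ord0 * r i); last first.
  by apply: ler_sum => i _; apply: ler_wpM2l => //; case: (hr i).
have [||_ /=] := @expect_invert n p h r (enum 'I_n) 0 p0.
- by rewrite add0r big_enum.
- by move=> i; case: (hr i).
by rewrite big_enum.
Qed.

End Programs.

(** * Euclidean and entropic geometry *)

Section Vectors.
Context {R : realType}.

Definition dot n (u v : 'cV[R]_n) : R := \sum_i u i ord0 * v i ord0.
Definition sqn n (u : 'cV[R]_n) : R := dot u u.
Definition vsum n (u : 'cV[R]_n) : R := \sum_i u i ord0.
Definition vln n (u : 'cV[R]_n) : 'cV[R]_n := \col_i ln (u i ord0).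
(** A zero coordinate of [u] kills its term, which is the convention 0 log 0 = 0. *)
Definition kl n (u v : 'cV[R]_n) : R := dot u (vln u - vln v).
Definition ballproj n (v : 'cV[R]_n) : 'cV[R]_n := (Num.max 1 (l2norm v))^-1 *: v.
Definition softmax n (v : 'cV[R]_n) : 'cV[R]_n :=
  (\sum_i expR (v i ord0))^-1 *: \col_i expR (v i ord0).
(** The relative interior of the simplex, where the logarithms are meaningful and where [softmax]
    puts every iterate. *)
Definition psimplex n (y : 'cV[R]_n) : Prop := (forall i, 0 < y i ord0) /\ vsum y = 1.

Section Dot.
Context (n : nat).
Implicit Types u v w : 'cV[R]_n.

Lemma dotC u v : dot u v = dot v u.
Proof. by apply: eq_bigr => i _; rewrite mulrC. Qed.
Lemma dotDl u v w : dot (u + v) w = dot u w + dot v w.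
Proof. by rewrite -big_split; apply: eq_bigr => i _; rewrite /= mxE mulrDl. Qed.
Lemma dotNl u w : dot (- u) w = - dot u w.
Proof. by rewrite -sumrN; apply: eq_bigr => i _; rewrite mxE mulNr. Qed.
Lemma dotBl u v w : dot (u - v) w = dot u w - dot v w.
Proof. by rewrite dotDl dotNl. Qed.
Lemma dotZl c u w : dot (c *: u) w = c * dot u w.
Proof. by rewrite mulr_sumr; apply: eq_bigr => i _; rewrite mxE mulrA. Qed.
Lemma dotDr w u v : dot w (u + v) = dot w u + dot w v.
Proof. by rewrite dotC dotDl !(dotC w). Qed.
Lemma dotNr w u : dot w (- u) = - dot w u.
Proof. by rewrite dotC dotNl dotC. Qed.
Lemma dotBr w u v : dot w (u - v) = dot w u - dot w v.
Proof. by rewrite dotDr dotNr. Qed.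
Lemma dotZr w c u : dot w (c *: u) = c * dot w u.
Proof. by rewrite dotC dotZl dotC. Qed.
Lemma dot0l w : dot 0 w = 0.
Proof. by apply: big1 => i _; rewrite mxE mul0r. Qed.
Lemma dot0r w : dot w 0 = 0.
Proof. by rewrite dotC dot0l. Qed.
Lemma dot_const u c : dot u (const_mx c) = c * vsum u.
Proof. by rewrite mulr_sumr; apply: eq_bigr => i _; rewrite mxE mulrC. Qed.

Lemma vsumB u v : vsum (u - v) = vsum u - vsum v.
Proof. by rewrite -sumrB; apply: eq_bigr => i _; rewrite !mxE. Qed.

Definition dotE := (dotDl, dotNl, dotZl, dotDr, dotNr, dotZr).

Lemma dot_suml (I : finType) (f : I -> 'cV[R]_n) w :
  dot (\sum_i f i) w = \sum_i dot (f i) w.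
Proof.
rewrite exchange_big; apply: eq_bigr => k _ /=.
by rewrite summxE mulr_suml.
Qed.

Lemma sqn_ge0 u : 0 <= sqn u.
Proof. by apply: sumr_ge0 => i _; rewrite -expr2 sqr_ge0. Qed.

Lemma l2normE u : l2norm u = Num.sqrt (sqn u).
Proof. by congr Num.sqrt; apply: eq_bigr => i _; rewrite expr2. Qed.

Lemma l2norm_ge0 u : 0 <= l2norm u.
Proof. exact: sqrtr_ge0. Qed.

Lemma l2norm_sqr u : l2norm u ^+ 2 = sqn u.
Proof. by rewrite l2normE sqr_sqrtr// sqn_ge0. Qed.

Lemma sqn_eq0 u : sqn u = 0 -> u = 0.
Proof.
move=> /eqP; rewrite psumr_eq0 => [/allP u0|i _]; last by rewrite -expr2 sqr_ge0.
apply/colP => i; rewrite mxE; apply/eqP.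
by have := u0 i (mem_index_enum _); rewrite /= mulf_eq0 orbb.
Qed.

Lemma cauchy_schwarz u v : dot u v <= l2norm u * l2norm v.
Proof.
apply: (le_trans (ler_norm _)).
rewrite -(ler_pXn2r (n := 2))// ?nnegrE ?mulr_ge0 ?l2norm_ge0//.
rewrite real_normK ?num_real// exprMn !l2norm_sqr.
have [v0|v0] := eqVneq (sqn v) 0.
  by rewrite (sqn_eq0 v0) dot0r /sqn dot0r mulr0 expr0n.
have vp : 0 < sqn v by rewrite lt_neqAle eq_sym v0 sqn_ge0.
have := sqn_ge0 (sqn v *: u - dot u v *: v).
rewrite {1}/sqn !dotE (dotC v u) -/(sqn u) -/(sqn v) => H.
have : 0 <= sqn v * (sqn u * sqn v - dot u v ^+ 2) by lra.
by rewrite pmulr_rge0// subr_ge0.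
Qed.

Lemma holder u v M : (forall i, `|u i ord0| <= M) -> dot u v <= M * l1norm v.
Proof.
move=> uM; rewrite mulr_sumr; apply: ler_sum => i _.
apply: (le_trans (ler_norm _)); rewrite normrM.
by apply: ler_wpM2r => //; exact: uM.
Qed.

Lemma l1norm_ge0 u : 0 <= l1norm u.
Proof. by apply: sumr_ge0. Qed.

Lemma simplexE u : simplex u <-> (forall i, 0 <= u i ord0) /\ vsum u = 1.
Proof.
split=> -[u0 u1]; split=> //; rewrite -u1; apply: eq_bigr => i _;
  by rewrite ger0_norm.
Qed.

Lemma psimplexW u : psimplex u -> simplex u.
Proof. by move=> [u0 u1]; apply/simplexE; split=> // i; exact: ltW. Qed.

Lemma l1normB_simplex u v : simplex u -> simplex v -> l1norm (u - v) <= 2.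
Proof.
move=> [_ u1] [_ v1]; have -> : 2 = l1norm u + l1norm v by rewrite u1 v1.
rewrite -big_split /=; apply: ler_sum => i _; rewrite !mxE.
exact: ler_normB.
Qed.

Lemma l2ball_sqn u : l2ball u -> sqn u <= 1.
Proof. by rewrite /l2ball /= -l2norm_sqr => u1; rewrite expr_le1// l2norm_ge0. Qed.

Lemma l2norm_le u c : 0 <= c -> sqn u <= c ^+ 2 -> l2norm u <= c.
Proof. by move=> c0 uc; rewrite l2normE -(ger0_norm c0) -sqrtr_sqr ler_wsqrtr. Qed.

Lemma l2normZ c u : l2norm (c *: u) = `|c| * l2norm u.
Proof.
by rewrite !l2normE /sqn !dotE mulrA -expr2 sqrtrM ?sqr_ge0// sqrtr_sqr.
Qed.

Lemma l2normD u v : l2norm (u + v) <= l2norm u + l2norm v.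
Proof.
apply: l2norm_le; first by rewrite addr_ge0 ?l2norm_ge0.
rewrite /sqn !dotE sqrrD !l2norm_sqr (dotC v u) -/(sqn u) -/(sqn v).
have := cauchy_schwarz u v; lra.
Qed.

End Dot.

Lemma dot_mulmx m n (A : 'M[R]_(m, n)) y x : dot (A^T *m y) x = dot y (A *m x).
Proof.
transitivity (\sum_j \sum_i A i j * y i ord0 * x j ord0).
  apply: eq_bigr => j _; rewrite mxE mulr_suml; apply: eq_bigr => i _.
  by rewrite mxE.
rewrite exchange_big; apply: eq_bigr => i _; rewrite mxE mulr_sumr.
by apply: eq_bigr => j _; rewrite mulrCA mulrA mulrAC.
Qed.

Lemma bilinE m n (A : 'M[R]_(m, n)) y x : bilin A y x = dot y (A *m x).
Proof. by rewrite /bilin -mulmxA mxE; apply: eq_bigr => i _; rewrite mxE. Qed.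

Lemma l2norm_row m n (A : 'M[R]_(m, n)) i : l2norm (row i A)^T <= l2inf_norm A.
Proof. exact: (le_bigmax_cond _ (fun i => l2norm (row i A)^T)). Qed.

Lemma l2inf_norm_ge0 m n (A : 'M[R]_(m, n)) : 0 <= l2inf_norm A.
Proof. exact: bigmax_ge_id. Qed.

Lemma sqn_row m n (A : 'M[R]_(m, n)) i :
  \sum_j A i j ^+ 2 <= l2inf_norm A ^+ 2.
Proof.
have -> : \sum_j A i j ^+ 2 = l2norm (row i A)^T ^+ 2.
  by rewrite l2norm_sqr; apply: eq_bigr => j _; rewrite !mxE expr2.
by rewrite ler_pXn2r ?nnegrE ?l2norm_ge0 ?l2inf_norm_ge0// l2norm_row.
Qed.

Lemma mulmx_bound m n (A : 'M[R]_(m, n)) x i :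
  `|(A *m x) i ord0| <= l2inf_norm A * l2norm x.
Proof.
have B z : (A *m z) i ord0 = dot (row i A)^T z.
  by rewrite mxE; apply: eq_bigr => j _; rewrite !mxE.
have H z : (A *m z) i ord0 <= l2inf_norm A * l2norm z.
  rewrite B; apply: (le_trans (cauchy_schwarz _ _)).
  by apply: ler_wpM2r; rewrite ?l2norm_ge0 ?l2norm_row.
rewrite ler_norml H andbT lerNl.
have := H (- x); rewrite mulmxN mxE.
by rewrite -[in l2norm (- x)]scaleN1r l2normZ normrN1 mul1r.
Qed.

Lemma dot_mulmx_le m n (A : 'M[R]_(m, n)) y x :
  dot y (A *m x) <= l2inf_norm A * l2norm x * l1norm y.
Proof. by rewrite dotC; apply: holder; exact: mulmx_bound. Qed.

(** * Mirror steps and inequalities for the relative entropy *)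

Section Projections.
Context (n : nat).
Implicit Types u v w : 'cV[R]_n.

Lemma ballproj_ball v : l2ball (ballproj v).
Proof.
have M0 : 0 < Num.max 1 (l2norm v) by rewrite lt_max ltr01.
rewrite /l2ball /= l2normZ gtr0_norm ?invr_gt0// mulrC ler_pdivrMr// mul1r.
by rewrite le_max lexx orbT.
Qed.

(** The variational inequality of the projection. Outside the ball the residual is (M - 1) p with
    |p| = 1, which reduces it to <p, u> <= 1. *)
Lemma ballproj_le v u : l2ball u -> dot (v - ballproj v) (u - ballproj v) <= 0.
Proof.
move=> u1; set M := Num.max 1 (l2norm v).
have M1 : 1 <= M by rewrite le_max lexx.
have Mp : 0 < M by exact: lt_le_trans M1.
set p := ballproj v; have Ev : v = M *: p.
  by rewrite scalerA divff ?gt_eqF// scale1r.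
have [M1'|M1'] := eqVneq M 1; first by rewrite Ev M1' scale1r subrr dot0l.
have Mv : M = l2norm v.
  rewrite /M; case: (ltP 1 (l2norm v)) => [/ltW/max_r //|/max_l Mx].
  by rewrite /M Mx eqxx in M1'.
have p1 : sqn p = 1.
  by rewrite -l2norm_sqr /p /ballproj -/M l2normZ gtr0_norm ?invr_gt0// -Mv mulVf ?expr1n// gt_eqF.
have -> : v - p = (M - 1) *: p by rewrite {1}Ev scalerBl scale1r.
rewrite dotZl dotBr -/(sqn p) p1 mulr_ge0_le0 ?subr_ge0// subr_le0.
apply: (le_trans (cauchy_schwarz _ _)).
have -> : l2norm p = 1 by rewrite l2normE p1 sqrtr1.
by rewrite mul1r.
Qed.

(** Optimality of the projected point, expanded by the three-point identity for the two distances.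
    Taking h = 0 gives the plain mirror step of the outer loop. *)
Lemma prox_ball (eta h : R) (x x0 g v u : 'cV[R]_n) :
  0 <= 1 + h -> (1 + h) *: v = x + h *: x0 - eta *: g -> l2ball u ->
  eta * dot g (ballproj v - u) <=
    (sqn (u - x) - sqn (u - ballproj v) - sqn (ballproj v - x)) / 2 +
    h * ((sqn (u - x0) - sqn (u - ballproj v) - sqn (ballproj v - x0)) / 2).
Proof.
move=> h0 Ev ub; have := ballproj_le v ub; move: (ballproj v) => x' H.
have : dot ((1 + h) *: v - (1 + h) *: x') (u - x') <= 0.
  by rewrite -scalerBr dotZl mulr_ge0_le0.
rewrite Ev /sqn !dotE.
rewrite (dotC u x') (dotC u x) (dotC u x0) (dotC x' x) (dotC x' x0).
lra.
Qed.

Lemma sumexp_gt0 v : (0 < n)%N -> 0 < \sum_i expR (v i ord0).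
Proof.
move=> n0; rewrite (bigD1 (Ordinal n0)) //= ltr_wpDr ?expR_gt0//.
by apply: sumr_ge0 => i _; exact: expR_ge0.
Qed.

Lemma softmax_psimplex v : (0 < n)%N -> psimplex (softmax v).
Proof.
move=> n0; have Z0 := sumexp_gt0 v n0; split=> [i|].
  by rewrite !mxE mulr_gt0 ?invr_gt0 ?expR_gt0.
transitivity ((\sum_i expR (v i ord0))^-1 * \sum_i expR (v i ord0)).
  rewrite mulr_sumr.
  by apply: eq_bigr => i _; rewrite !mxE.
by rewrite mulVf// gt_eqF.
Qed.

Lemma vln_softmax v : (0 < n)%N ->
  vln (softmax v) = v - const_mx (ln (\sum_i expR (v i ord0))).
Proof.
move=> n0; have Z0 := sumexp_gt0 v n0; apply/colP => i; rewrite !mxE.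
by rewrite lnM ?posrE ?invr_gt0 ?expR_gt0// lnV ?posrE// expRK addrC.
Qed.

Lemma kl_three u v w : kl u v - kl u w - kl w v = dot (u - w) (vln w - vln v).
Proof. by rewrite /kl !dotE; lra. Qed.

(** An equality, because the minimiser lies in the interior of the simplex: the logarithm of the
    normalising constant is a constant vector, orthogonal to u - y' as both points have coordinate
    sum 1. *)
Lemma prox_simplex (eta h : R) (y y0 g v u : 'cV[R]_n) :
  (0 < n)%N -> (1 + h) *: v = vln y + h *: vln y0 - eta *: g -> vsum u = 1 ->
  eta * dot g (softmax v - u) =
    (kl u y - kl u (softmax v) - kl (softmax v) y) +
    h * (kl u y0 - kl u (softmax v) - kl (softmax v) y0).
Proof.
move=> n0 Ev u1; have [_] := softmax_psimplex v n0; have := vln_softmax v n0.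
move: (softmax v) (ln _) => y' c Ey y'1; rewrite !kl_three -[h * _]dotZr -dotDr.
rewrite [X in _ = dot _ X](_ : _ = - (eta *: g) - const_mx ((1 + h) * c)).
  by rewrite [RHS]dotBr dotNr dotZr dot_const vsumB u1 y'1 (dotC _ g) !dotBr; ring.
by rewrite Ey; apply/colP => i; move/colP/(_ i): Ev; rewrite !mxE; lra.
Qed.

(** Coordinatewise this is [ln t <= t - 1] at t = p e^a / y; the coordinate sums of p and y, both
    equal to 1, are interchangeable on the right. *)
Lemma gibbs (a p y : 'cV[R]_n) : psimplex p -> simplex y ->
  dot a y - kl y p <= \sum_i p i ord0 * (expR (a i ord0) - 1).
Proof.
move=> [p0 p1] /simplexE[y0 y1].
have -> : \sum_i p i ord0 * (expR (a i ord0) - 1) =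
    \sum_i (p i ord0 * expR (a i ord0) - y i ord0).
  rewrite [RHS]sumrB -/(vsum y) y1.
  by under eq_bigr do rewrite mulrBr mulr1; rewrite sumrB -/(vsum p) p1.
rewrite /kl /dot -sumrB; apply: ler_sum => i _; rewrite !mxE.
have := y0 i; rewrite le_eqVlt => /predU1P[<-|yp].
  by rewrite mulr0 mul0r !subr0 mulr_ge0 ?expR_ge0// ltW.
set b := y i ord0 in yp *; set q := p i ord0.
have qp : 0 < q := p0 i.
have : ln (q * expR (a i ord0) / b) <= q * expR (a i ord0) / b - 1.
  have z0 : 0 < q * expR (a i ord0) / b by rewrite divr_gt0 ?mulr_gt0 ?expR_gt0.
  by have := le_ln1Dx (x := q * expR (a i ord0) / b - 1); rewrite addrCA subrr addr0; apply; lra.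
rewrite lnM ?posrE ?invr_gt0 ?mulr_gt0 ?expR_gt0// lnM ?posrE ?expR_gt0//.
rewrite lnV ?posrE// expRK => /(ler_wpM2l (ltW yp)).
have -> : b * (q * expR (a i ord0) / b - 1) = q * expR (a i ord0) - b.
  by rewrite mulrBr mulr1 mulrCA divff ?mulr1// gt_eqF.
lra.
Qed.

(** From exp(- z / 2) >= 1 - z / 2 one gets exp z <= (1 - z / 2)^-2, and the rest is polynomial. The
    constant 2 is where the two sides of that polynomial comparison meet at z = 1. *)
Lemma expR_le_sqr (z : R) : `|z| <= 1 -> expR z <= 1 + z + 2 * z ^+ 2.
Proof.
rewrite ler_norml => /andP[z1 z2].
have h0 : 0 < 1 - z / 2 by lra.
have H : (1 - z / 2) * expR (z / 2) <= 1.
  have := expR_ge1Dx (- (z / 2)); rewrite expRN => H.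
  by rewrite -ler_pdivlMr ?expR_gt0// div1r.
have e0 := expR_gt0 (z / 2).
have -> : expR z = expR (z / 2) ^+ 2 by rewrite expr2 -expRD; congr expR; lra.
have H2 : ((1 - z / 2) * expR (z / 2)) ^+ 2 <= 1.
  by rewrite expr_le1// mulr_ge0// ltW.
rewrite exprMn in H2.
rewrite -(ler_pM2l (exprn_gt0 2 h0)); apply: (le_trans H2).
have -> : (1 - z / 2) ^+ 2 * (1 + z + 2 * z ^+ 2) =
  1 + z ^+ 2 * ((1 - z) * (5 / 2 - z) / 2) by field.
by rewrite lerDl mulr_ge0 ?sqr_ge0//; nra.
Qed.

(** For centred increments, whose entries reach 2 / eta. Squaring the previous bound at z / 2 leaves
    z^2 (2 - z) (4 + z) / 4 >= 0, tight at z = 2; this is the origin of 13/4. *)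
Lemma expR_le_sqr2 (z : R) : `|z| <= 2 -> expR z <= 1 + z + 13 / 4 * z ^+ 2.
Proof.
move=> z2; have z1 : `|z / 2| <= 1.
  by move: z2; rewrite !ler_norml; lra.
have H := expR_le_sqr z1.
have -> : expR z = expR (z / 2) ^+ 2 by rewrite expr2 -expRD; congr expR; lra.
have e0 := expR_gt0 (z / 2).
apply: (@le_trans _ _ ((1 + z / 2 + 2 * (z / 2) ^+ 2) ^+ 2)).
  by rewrite ler_pXn2r// nnegrE; lra.
move: z2; rewrite ler_norml => /andP[a b].
have : 0 <= z ^+ 2 * ((2 - z) * (4 + z)) by rewrite mulr_ge0 ?sqr_ge0//; nra.
nra.
Qed.

(** The Gibbs inequality at -z, followed by the quadratic bound on exp. The result is in the local
    norm at y, which averages coordinate by coordinate; a bound by the largest z_i^2 would require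
    the mean of a maximum. *)
Lemma entropic_step (z y y' : 'cV[R]_n) (b c : R) :
  (forall t : R, `|t| <= b -> expR t <= 1 + t + c * t ^+ 2) ->
  psimplex y -> simplex y' -> (forall i, `|z i ord0| <= b) ->
  dot z (y - y') - kl y' y <= c * \sum_i y i ord0 * z i ord0 ^+ 2.
Proof.
move=> eb py sy' zb; have := gibbs (- z) py sy'.
rewrite dotBr dotNl => H.
rewrite -lerBrDl -lerBrDl in H *.
have : \sum_i y i ord0 * (expR ((- z) i ord0) - 1) <=
   - dot z y + c * \sum_i y i ord0 * z i ord0 ^+ 2.
  rewrite mulr_sumr -sumrN -big_split /=; apply: ler_sum => i _; rewrite mxE.
  have := eb (- z i ord0); rewrite normrN => /(_ (zb i)).
  rewrite sqrrN; set e := expR _ => He.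
  have y0 : 0 < y i ord0 by case: py.
  rewrite [leRHS](_ : _ = y i ord0 * (- z i ord0 + c * z i ord0 ^+ 2)); last by ring.
  by rewrite ler_pM2l//; lra.
by lra.
Qed.

Lemma euclidean_step (z x x' : 'cV[R]_n) :
  dot z (x - x') - sqn (x' - x) / 2 <= sqn z / 2.
Proof.
have := sqn_ge0 (z + (x' - x)); rewrite /sqn !dotE.
by rewrite (dotC x' z) (dotC x z) (dotC x' x); lra.
Qed.

(* KL dominates the squared Hellinger distance, which dominates a quarter of
   the squared l1 distance. *)
Lemma pinsker4 (p q : 'cV[R]_n) : simplex p -> psimplex q ->
  l1norm (p - q) ^+ 2 <= 4 * kl p q.
Proof.
move=> /simplexE[p0 p1] [q0 q1].
pose sp : 'cV[R]_n := \col_i Num.sqrt (p i ord0).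
pose sq : 'cV[R]_n := \col_i Num.sqrt (q i ord0).
have sqnp : sqn sp = 1.
  by rewrite -p1; apply: eq_bigr => i _; rewrite !mxE -expr2 sqr_sqrtr.
have sqnq : sqn sq = 1.
  by rewrite -q1; apply: eq_bigr => i _; rewrite !mxE -expr2 sqr_sqrtr// ltW.
have klH : sqn (sp - sq) <= kl p q.
  have -> : sqn (sp - sq) = 2 * (vsum p - dot sp sq).
    by rewrite /sqn !dotE (dotC sq sp) -/(sqn sp) -/(sqn sq) sqnp sqnq p1; ring.
  rewrite -lerN2 -mulrN opprB.
  rewrite /kl /dot /vsum -sumrB mulr_sumr -sumrN; apply: ler_sum => i _.
  rewrite !mxE; set a := p i ord0; set b := q i ord0.
  have b0 : 0 < b := q0 i.
  have := p0 i; rewrite -/a le_eqVlt => /predU1P[<-|a0].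
    by rewrite sqrtr0 !mul0r subr0 oppr0 mulr0.
  have sa : 0 < Num.sqrt a by rewrite sqrtr_gt0.
  have sb : 0 < Num.sqrt b by rewrite sqrtr_gt0.
  have ea : a = Num.sqrt a ^+ 2 by rewrite sqr_sqrtr// ltW.
  have eb : b = Num.sqrt b ^+ 2 by rewrite sqr_sqrtr// ltW.
  have L2 (r : R) : 0 < r -> ln (r ^+ 2) = 2 * ln r.
    by move=> r0; rewrite expr2 lnM ?posrE//; ring.
  have -> : ln a = 2 * ln (Num.sqrt a) by rewrite -L2// -ea.
  have -> : ln b = 2 * ln (Num.sqrt b) by rewrite -L2// -eb.
  move: (Num.sqrt a) (Num.sqrt b) sa sb ea {eb} => s t s0 t0 ea.
  (* Multiplied by a = p_i, this is p_i ln (p_i / q_i) >= 2 (p_i - sqrt (p_i q_i)), whose sum is the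
     squared Hellinger distance. *)
  have : ln (t / s) <= t / s - 1.
    have z0 : 0 < t / s by rewrite divr_gt0.
    by have := le_ln1Dx (x := t / s - 1); rewrite addrCA subrr addr0; apply; lra.
  rewrite lnM ?posrE ?invr_gt0// lnV ?posrE// => /(ler_wpM2l (ltW a0)).
  have -> : a * (t / s - 1) = s * t - a.
    by rewrite mulrBr mulr1 mulrCA {1}ea expr2 mulfK ?gt_eqF// mulrC.
  lra.
have : l1norm (p - q) <= l2norm (\col_i `|(sp - sq) i ord0|) * l2norm (sp + sq).
  apply: le_trans (cauchy_schwarz _ _); apply: ler_sum => i _; rewrite !mxE.
  set s := Num.sqrt _; set t := Num.sqrt _.
  have -> : p i ord0 - q i ord0 = (s - t) * (s + t).
    by rewrite -subr_sqr !sqr_sqrtr// ltW.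
  by rewrite normrM (ger0_norm (x := s + t))// addr_ge0 ?sqrtr_ge0.
rewrite -(ler_pXn2r (n := 2)) ?nnegrE ?mulr_ge0 ?l2norm_ge0 ?l1norm_ge0//.
rewrite exprMn !l2norm_sqr => H; apply: (le_trans H).
have -> : sqn (\col_i `|(sp - sq) i ord0|) = sqn (sp - sq).
  by apply: eq_bigr => i _; rewrite !mxE -normrM ger0_norm// -expr2 sqr_ge0.
rewrite mulrC; apply: ler_pM; rewrite ?sqn_ge0//.
have := sqn_ge0 (sp - sq).
by rewrite /sqn !dotE (dotC sq sp) -/(sqn sp) -/(sqn sq) sqnp sqnq; lra.
Qed.

Lemma kl_ge0 (p q : 'cV[R]_n) : simplex p -> psimplex q -> 0 <= kl p q.
Proof. by move=> sp sq; have := pinsker4 sp sq; have := sqr_ge0 (l1norm (p - q)); lra. Qed.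

End Projections.
End Vectors.

(** * One step of the loops *)

Section Steps.
Context {R : realType}.

Lemma evals_projX n (v : 'cV[R]_n) : evals (projX v) (ballproj v).
Proof.
apply: evals_bind (evals_vnorm2 v) _; apply: evals_bind (evals_lit 1) _.
by apply: evals_bind (evals_max _ _) _; exact: evals_vdiv.
Qed.

Lemma evals_projY n (v : 'cV[R]_n) : evals (projY v) (softmax v).
Proof.
apply: evals_bind (evals_vmap v evals_exp) _.
apply: evals_bind (evals_vnorm1 _) _.
apply: evals_eq (evals_vdiv _ _) _; congr (_^-1 *: _).
by apply: eq_bigr => i _; rewrite mxE ger0_norm// expR_ge0.
Qed.

Lemma evals_vlog n (v : 'cV[R]_n) : evals (vmap plog v) (vln v).
Proof. exact: evals_vmap evals_log. Qed.

Definition clamp (tau a : R) : R := Num.min tau (Num.max (- tau) a).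

Lemma evals_clip n (tau : R) (v : 'cV[R]_n) :
  evals (clip tau v) (\col_i clamp tau (v i ord0)).
Proof.
apply: evals_bind (evals_neg tau) _; apply: evals_vmap => a.
by apply: evals_bind (evals_max _ _) _; exact: evals_min.
Qed.

Lemma clamp_cases (tau a : R) : 0 < tau ->
  [\/ clamp tau a = a /\ `|a| <= tau, clamp tau a = tau /\ tau <= a
    | clamp tau a = - tau /\ a <= - tau].
Proof.
move=> t0; rewrite /clamp; case: (leP (- tau) a) => a1.
  case: (leP tau a) => a2; first by constructor 2.
  by constructor 1; rewrite ler_norml a1 ltW.
by constructor 3; rewrite minElt ltNge (_ : - tau <= tau) ?ltW//=; lra.
Qed.

Lemma clamp_le (tau a : R) : 0 < tau -> `|clamp tau a| <= tau.
Proof.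
by move=> t0; case: (clamp_cases a t0) => -[-> h] //; rewrite ?normrN gtr0_norm.
Qed.

Lemma clamp_sqr (tau a : R) : 0 < tau -> clamp tau a ^+ 2 <= a ^+ 2.
Proof. by move=> t0; case: (clamp_cases a t0) => -[-> h] //; nra. Qed.

(** The excess |a| - tau is at most a^2 / (4 tau), because (|a| - 2 tau)^2 >= 0. *)
Lemma clamp_bias (tau a : R) : 0 < tau -> `|clamp tau a - a| <= a ^+ 2 / (4 * tau).
Proof.
move=> t0; have t4 : 0 < 4 * tau by lra.
have h0 : 0 <= (`|a| - 2 * tau) ^+ 2 := sqr_ge0 _.
have := sqr_ge0 a; rewrite ler_pdivlMr// => a2.
case: (clamp_cases a t0) => -[-> h].
- by rewrite subrr normr0 mul0r.
- by rewrite distrC ger0_norm ?subr_ge0//; have := sqr_ge0 (a - 2 * tau); nra.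
- by rewrite ger0_norm; [have := sqr_ge0 (a + 2 * tau); nra|lra].
Qed.

(** * The two sampled increments and the deterministic rest of an iteration *)

Section Increments.
Context (m n : nat) (A : 'M[R]_(m, n)).
Let L := l2inf_norm A.

(** Sampling seen as a finite distribution with known mean and second moment. The index type is
    existential so that a zero difference, handled by a one-point distribution, has the same
    interface as genuine sampling. *)
Lemma incX_spec (y y0 : 'cV[R]_m) :
  exists (I : finType) (p : I -> R) (xi : I -> 'cV[R]_n),
  [/\ (forall i, 0 <= p i) /\ \sum_i p i = 1,
    \sum_i p i *: xi i = A^T *m (y - y0),
    \sum_i p i * sqn (xi i) <= L ^+ 2 * l1norm (y - y0) ^+ 2
  & forall F c, (forall i, fle (F (xi i)) (c i)) ->
      fle (expect (incX (sparse_of A) y y0) F) (\sum_i p i * c i)].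
Proof.
have [d Ed] : exists d, d = y - y0 by exists (y - y0).
rewrite -Ed; set s := l1norm d.
have s0 : 0 <= s := l1norm_ge0 d.
have E F : expect (incX (sparse_of A) y y0) F =
  if 0 < s then expect (sample (\col_i (`|d i ord0| / s))) (fun oi =>
    if oi is Some i then F ((d i ord0 / (`|d i ord0| / s)) *: (row i A)^T)
    else F 0) else F 0.
  rewrite /incX (expect_evals _ _ (evals_vsub _ _)) -Ed.
  rewrite (expect_evals _ _ (evals_vnorm1 _)) -/s.
  rewrite (expect_evals _ _ (evals_lit _)) (expect_evals _ _ (evals_less _ _)).
  case: ifP => // _.
  have H : forall a : R, evals (a' <~ pabs a ;; pdiv a' s) (`|a| / s).
    by move=> a; apply: evals_bind (evals_abs a) _; exact: evals_div.
  rewrite (expect_evals _ _ (evals_vmap _ H)) expect_bind.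
  congr (expect _ _); apply/funext => -[i|] //=.
  by rewrite densify_srow (evals_vscale _ _).2 mxE.
case: (ltP 0 s) => [sp|sn]; last first.
  have s00 : s = 0 by apply/eqP; rewrite eq_le sn s0.
  exists unit, (fun=> 1), (fun=> 0); split.
  - by split=> //; rewrite (big_pred1 tt)//; case.
  - rewrite (big_pred1 tt) => [|[]]//; rewrite scale1r.
    suff -> : d = 0 by rewrite mulmx0.
    apply/colP => i; rewrite [RHS]mxE; apply/eqP; rewrite -normr_le0.
    by apply: le_trans sn; rewrite /s /l1norm (bigD1 i)//= lerDl sumr_ge0.
  - by rewrite (big_pred1 tt) => [|[]]//; rewrite /sqn dot0l mulr0 mulr_ge0 ?sqr_ge0.
  - move=> F c Fc; rewrite (big_pred1 tt) => [|[]]//; rewrite mul1r E ltNge sn /=.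
    exact: Fc tt.
have sne : s != 0 by rewrite gt_eqF.
(* At d_i = 0 the coefficient is the quotient 0 / 0, which evaluates to 0. *)
have pd i : `|d i ord0| / s * (d i ord0 / (`|d i ord0| / s)) = d i ord0.
  have [->|d0] := eqVneq (d i ord0) 0; first by rewrite !mul0r mulr0.
  by rewrite mulrC divfK// mulf_neq0 ?invr_neq0 ?normr_eq0.
have dc i : d i ord0 * (d i ord0 / (`|d i ord0| / s)) = s * `|d i ord0|.
  have [->|d0] := eqVneq (d i ord0) 0; first by rewrite !mul0r normr0 mulr0.
  have d2 : d i ord0 * d i ord0 = `|d i ord0| * `|d i ord0|.
    by rewrite -normrM ger0_norm// -expr2 sqr_ge0.
  by rewrite mulrA d2; field; rewrite ?normr_eq0 ?d0 ?sne.
exists 'I_m, (fun i => `|d i ord0| / s),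
  (fun i => (d i ord0 / (`|d i ord0| / s)) *: (row i A)^T).
split.
- by split=> [i|]; [rewrite divr_ge0|rewrite -mulr_suml divff].
- apply/colP => k; rewrite summxE !mxE; apply: eq_bigr => i _.
  by rewrite !mxE mulrA pd mulrC.
(* Probabilities proportional to |d_i| turn p_i (d_i / p_i)^2 into s |d_i|, and the weights s |d_i|
   sum to s^2. *)
- rewrite -/s [leRHS](_ : _ = \sum_i (L ^+ 2 * s) * `|d i ord0|); last first.
    by rewrite -mulr_sumr expr2 mulrA.
  apply: ler_sum => i _.
  have -> : `|d i ord0| / s * sqn ((d i ord0 / (`|d i ord0| / s)) *: (row i A)^T) =
      (s * `|d i ord0|) * sqn (row i A)^T.
    by rewrite -dc -[in X in _ = X * _ * _]pd /sqn !dotE; ring.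
  rewrite [leRHS](_ : _ = s * `|d i ord0| * L ^+ 2); last by ring.
  apply: ler_wpM2l; first exact: mulr_ge0.
  by rewrite -l2norm_sqr ler_pXn2r ?nnegrE ?l2norm_ge0 ?l2inf_norm_ge0// l2norm_row.
- move=> F c Fc; rewrite E sp.
  rewrite (eq_bigr (fun i => (\col_i (`|d i ord0| / s)) i ord0 * c i)); last first.
    by move=> i _; rewrite mxE.
  apply: expect_sample => //; first by move=> i; rewrite mxE divr_ge0.
  transitivity (s / s); last by rewrite divff.
  by rewrite {2}/s /l1norm mulr_suml; apply: eq_bigr => i _; rewrite mxE.
Qed.

(** Clipping buys the uniform bound tau at the price of a bias, which [clamp_bias] controls by the
    second moment of the unclipped increment. Bias and second moment are bounded for each coordinate
    separately, as the local norm requires. *)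
Lemma incY_spec (tau : R) (x x0 : 'cV[R]_n) : 0 < tau ->
  exists (J : finType) (q : J -> R) (xi : J -> 'cV[R]_m),
  [/\ (forall j, 0 <= q j) /\ \sum_j q j = 1,
    forall j k, `|xi j k ord0| <= tau,
    forall k, `|\sum_j q j * xi j k ord0 + (A *m (x - x0)) k ord0| <=
      L ^+ 2 * sqn (x - x0) / (4 * tau),
    forall k, \sum_j q j * xi j k ord0 ^+ 2 <= L ^+ 2 * sqn (x - x0)
  & forall F c, (forall j, fle (F (xi j)) (c j)) ->
      fle (expect (incY (sparse_of A) tau x x0) F) (\sum_j q j * c j)].
Proof.
move=> t0; have [d Ed] : exists d, d = x - x0 by exists (x - x0).
rewrite -Ed; set s := l2norm d.
have s0 : 0 <= s := l2norm_ge0 d.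
have ss : s ^+ 2 = sqn d := l2norm_sqr d.
pose q j := d j ord0 ^+ 2 / s ^+ 2.
pose a j k := d j ord0 / q j * A k j.
pose xi j : 'cV[R]_m := \col_k - clamp tau (a j k).
have E F : expect (incY (sparse_of A) tau x x0) F =
  if 0 < s then expect (sample (\col_j q j)) (fun oj =>
    if oj is Some j then F (xi j) else F 0) else F 0.
  rewrite /incY (expect_evals _ _ (evals_vsub _ _)) -Ed.
  rewrite (expect_evals _ _ (evals_vnorm2 _)) -/s.
  rewrite (expect_evals _ _ (evals_lit _)) (expect_evals _ _ (evals_less _ _)).
  case: ifP => // _; rewrite (expect_evals _ _ (evals_sqr _)).
  have H : forall b : R, evals (b2 <~ psqr b ;; pdiv b2 (s ^+ 2)) (b ^+ 2 / s ^+ 2).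
    by move=> b; apply: evals_bind (evals_sqr b) _; exact: evals_div.
  rewrite (expect_evals _ _ (evals_vmap _ H)) expect_bind.
  congr (expect _ _); apply/funext => -[j|] //.
  rewrite (expect_evals _ _ (evals_div _ _)) densify_scol.
  rewrite (expect_evals _ _ (evals_vscale _ _)) (expect_evals _ _ (evals_clip _ _)).
  rewrite (evals_vneg _).2; congr F; apply/colP => k; rewrite !mxE.
  by rewrite /a /q.
case: (ltP 0 s) => [sp|sn]; last first.
  have d0 : d = 0.
    by apply: sqn_eq0; rewrite -ss (_ : s = 0) ?expr0n//; lra.
  exists unit, (fun=> 1), (fun=> 0); split.
  - by split=> //; rewrite (big_pred1 tt)//; case.
  - by move=> _ k; rewrite mxE normr0 ltW.
  - move=> k; rewrite (big_pred1 tt) => [|[]]//; rewrite d0 mulmx0 mxE mulr0 addr0.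
    by rewrite /sqn dot0l normr0 mulr0 mul0r.
  - move=> k; rewrite (big_pred1 tt) => [|[]]//; rewrite d0 mxE expr0n mulr0.
    by rewrite /sqn dot0l mulr0.
  - move=> F c Fc; rewrite (big_pred1 tt) => [|[]]//; rewrite mul1r E ltNge sn /=.
    exact: Fc tt.
have sne : s != 0 by rewrite gt_eqF.
have q0 j : 0 <= q j by rewrite divr_ge0 ?sqr_ge0.
have q1 : \sum_j q j = 1.
  transitivity (sqn d / s ^+ 2); last by rewrite -ss divff// sqrf_eq0.
  by rewrite /sqn /dot mulr_suml; apply: eq_bigr => i _; rewrite /q expr2.
have qa j k : q j * a j k = d j ord0 * A k j.
  rewrite /a /q; have [->|d0] := eqVneq (d j ord0) 0; first by rewrite expr0n !mul0r.
  by field; rewrite d0 sne.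
have qa2 j k : q j * a j k ^+ 2 = sqn d * A k j ^+ 2 \/
    (d j ord0 = 0 /\ q j * a j k ^+ 2 = 0).
  rewrite /a /q -ss; have [->|d0] := eqVneq (d j ord0) 0.
    by right; rewrite expr0n !mul0r.
  by left; field; rewrite d0 sne.
(* Columns are sampled, yet row norms appear: weights d_j^2 / |d|^2 make the second moment of
   coordinate k at most |d|^2 times the sum over j of A_kj^2. *)
have second k : \sum_j q j * a j k ^+ 2 <= L ^+ 2 * sqn d.
  rewrite mulrC; apply: (@le_trans _ _ (sqn d * \sum_j A k j ^+ 2)).
    rewrite mulr_sumr; apply: ler_sum => j _.
    by case: (qa2 j k) => [-> //|[_ ->]]; rewrite mulr_ge0 ?sqn_ge0 ?sqr_ge0.
  by apply: ler_wpM2l; [exact: sqn_ge0|exact: sqn_row].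
exists 'I_n, q, xi; split.
- by [].
- by move=> j k; rewrite mxE normrN; exact: clamp_le.
- move=> k.
  have -> : \sum_j q j * xi j k ord0 + (A *m d) k ord0 =
      - \sum_j q j * (clamp tau (a j k) - a j k).
    rewrite -sumrN [(A *m d) k ord0]mxE -big_split; apply: eq_bigr => j _ /=.
    by rewrite /xi mxE mulrBr qa; ring.
  rewrite normrN; apply: (le_trans (ler_norm_sum _ _ _)).
  apply: (@le_trans _ _ ((\sum_j q j * a j k ^+ 2) / (4 * tau))).
    rewrite mulr_suml; apply: ler_sum => j _.
    rewrite normrM (ger0_norm (q0 j)) -mulrA; apply: ler_wpM2l => //.
    exact: clamp_bias.
  by apply: ler_wpM2r => //; rewrite invr_ge0; lra.
- move=> k; apply: le_trans (second k); apply: ler_sum => j _.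
  by apply: ler_wpM2l => //; rewrite mxE sqrrN; exact: clamp_sqr.
- move=> F c Fc; rewrite E sp.
  rewrite (eq_bigr (fun j => (\col_j q j) j ord0 * c j)); last first.
    by move=> j _; rewrite mxE.
  apply: expect_sample => //; first by move=> i; rewrite mxE.
  by rewrite -q1; apply: eq_bigr => i _; rewrite mxE.
Qed.

Section Next.
Variables (T : nat) (alpha tau eta h : R).
Let point := @point R m n.

Definition inner_next (z0 g0 : point) (s : point * point) dx dy : point * point :=
  let x' := ballproj ((1 + h)^-1 *: (s.1.1 + h *: z0.1 - eta *: (g0.1 + dx))) in
  let y' := softmax
    ((1 + h)^-1 *: (vln s.1.2 + h *: vln z0.2 - eta *: (g0.2 + dy))) in
  ((x', y'), (s.2.1 + x', s.2.2 + y')).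

Definition outer_next (s : point * point) (S : point) : point * point :=
  let hx := T%:R^-1 *: S.1 in let hy := T%:R^-1 *: S.2 in
  ((ballproj (s.1.1 - alpha^-1 *: (A^T *m hy)),
    softmax (vln s.1.2 + alpha^-1 *: (A *m hx))),
   (s.2.1 + hx, s.2.2 + hy)).

Definition grad (z : point) : point := (A^T *m z.2, - (A *m z.1)).

Lemma evals_combine k (w : R) (u u0 g : 'cV[R]_k) :
  evals (combine w h eta u u0 g) (w *: (u + h *: u0 - eta *: g)).
Proof.
apply: evals_bind (evals_vscale _ _) _; apply: evals_bind (evals_vadd _ _) _.
apply: evals_bind (evals_vscale _ _) _; apply: evals_bind (evals_vsub _ _) _.
exact: evals_vscale.
Qed.

Let inner := inner_step (sparse_of A) tau eta h (1 + h)^-1.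

Lemma inner_tail (z0 g0 : point) s dx dy :
  evals (gx <~ vadd g0.1 dx;; gy <~ vadd g0.2 dy;;
    vx <~ combine (1 + h)^-1 h eta s.1.1 z0.1 gx;; x' <~ projX vx;;
    ly <~ vmap plog s.1.2;; ly0 <~ vmap plog z0.2;;
    vy <~ combine (1 + h)^-1 h eta ly ly0 gy;; y' <~ projY vy;;
    sx' <~ vadd s.2.1 x';; sy' <~ vadd s.2.2 y';;
    Ret ((x', y'), (sx', sy'))) (inner_next z0 g0 s dx dy).
Proof.
apply: evals_bind (evals_vadd _ _) _; apply: evals_bind (evals_vadd _ _) _.
apply: evals_bind (evals_combine _ _ _ _) _; apply: evals_bind (evals_projX _) _.
apply: evals_bind (evals_vlog _) _; apply: evals_bind (evals_vlog _) _.
apply: evals_bind (evals_combine _ _ _ _) _; apply: evals_bind (evals_projY _) _.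
by apply: evals_bind (evals_vadd _ _) _; apply: evals_bind (evals_vadd _ _) _.
Qed.

Lemma expect_inner z0 g0 s F :
  expect (inner z0 g0 s) F = expect (incX (sparse_of A) s.1.2 z0.2) (fun dx =>
    expect (incY (sparse_of A) tau s.1.1 z0.1) (fun dy =>
      F (inner_next z0 g0 s dx dy))).
Proof.
case: z0 g0 s => [x0 y0] [g0x g0y] [[x y] [sx sy]].
rewrite /inner /inner_step expect_bind; congr (expect _ _); apply/funext => dx.
rewrite expect_bind; congr (expect _ _); apply/funext => dy.
exact: (inner_tail (x0, y0) (g0x, g0y) ((x, y), (sx, sy)) dx dy).2.
Qed.

(** The increments stay arbitrary: the projections make the next iterate feasible whatever was
    sampled. *)
Lemma always_inner z0 g0 s (Q : point * point -> Prop) :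
  (forall dx dy, Q (inner_next z0 g0 s dx dy)) -> always (inner z0 g0 s) Q.
Proof.
case: z0 g0 s => [x0 y0] [g0x g0y] [[x y] [sx sy]] HQ.
apply: (always_bind (@always_true _ _ _)) => dx _.
apply: (always_bind (@always_true _ _ _)) => dy _ w.
by rewrite (inner_tail (x0, y0) (g0x, g0y) ((x, y), (sx, sy)) dx dy).1.
Qed.

Let outer := outer_step (sparse_of A) T alpha tau eta h (1 + h)^-1.

Lemma outer_tail (s : point * point) (r : point * point) :
  let B := sparse_of A in
  evals (T' <~ lit T;;
    hx <~ vmap (fun a => pdiv a T') r.2.1;;
    hy <~ vmap (fun a => pdiv a T') r.2.2;;
    one <~ lit 1;; ialpha <~ pdiv one alpha;;
    ATy <~ mulTv B hy;; bx <~ vscale ialpha ATy;; vx <~ vsub s.1.1 bx;; x' <~ projX vx;;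
    ly0 <~ vmap plog s.1.2;;
    Ax <~ mulv B hx;; b_y <~ vscale ialpha Ax;; vy <~ vadd ly0 b_y;; y' <~ projY vy;;
    Sx' <~ vadd s.2.1 hx;; Sy' <~ vadd s.2.2 hy;;
    Ret ((x', y'), (Sx', Sy'))) (outer_next s r.2).
Proof.
move=> B; apply: evals_bind (evals_lit _) _.
apply: evals_bind (evals_vdiv _ _) _; apply: evals_bind (evals_vdiv _ _) _.
apply: evals_bind (evals_lit _) _; apply: evals_bind (evals_div _ _) _.
apply: evals_bind (evals_mulTv _ _) _; apply: evals_bind (evals_vscale _ _) _.
apply: evals_bind (evals_vsub _ _) _; apply: evals_bind (evals_projX _) _.
apply: evals_bind (evals_vlog _) _; apply: evals_bind (evals_mulv _ _) _.
apply: evals_bind (evals_vscale _ _) _; apply: evals_bind (evals_vadd _ _) _.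
apply: evals_bind (evals_projY _) _; rewrite !mul1r.
by apply: evals_bind (evals_vadd _ _) _; apply: evals_bind (evals_vadd _ _) _.
Qed.

Lemma expect_outer s F :
  expect (outer s) F = expect (iterp T (inner s.1 (grad s.1)) (s.1, 0))
    (fun r => F (outer_next s r.2)).
Proof.
case: s => [[x0 y0] [Sx Sy]]; rewrite /outer /outer_step.
rewrite (expect_evals _ _ (evals_mulTv _ _)) (expect_evals _ _ (evals_mulv _ _)).
rewrite (expect_evals _ _ (evals_vneg _)) (expect_evals _ _ (evals_lit _)).
rewrite expect_bind; congr (expect _ _); apply/funext => r.
exact: (outer_tail ((x0, y0), (Sx, Sy)) r).2.
Qed.

Lemma always_outer s (P Q : point * point -> Prop) :
  always (iterp T (inner s.1 (grad s.1)) (s.1, 0)) P ->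
  (forall r, P r -> Q (outer_next s r.2)) -> always (outer s) Q.
Proof.
case: s => [[x0 y0] [Sx Sy]] HP PQ; rewrite /outer /outer_step.
apply: (always_evals (evals_mulTv _ _)); apply: (always_evals (evals_mulv _ _)).
apply: (always_evals (evals_vneg _)); apply: (always_evals (evals_lit _)).
apply: (always_bind HP) => r Pr w.
by rewrite (outer_tail ((x0, y0), (Sx, Sy)) r).1; exact: PQ.
Qed.

End Next.

End Increments.
End Steps.

(** * The inner loop *)

Section InnerLoop.
Context {R : realType}.

(** The squared local norm of [z] at [y], dual to the norm given by the Hessian of the entropy. *)
Definition wsq n (y z : 'cV[R]_n) : R := \sum_i y i ord0 * z i ord0 ^+ 2.

Lemma wsqZ n (y z : 'cV[R]_n) c : wsq y (c *: z) = c ^+ 2 * wsq y z.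
Proof. by rewrite mulr_sumr; apply: eq_bigr => i _; rewrite mxE exprMn mulrCA. Qed.

(** Here [d] is the sampled increment, [mu] its mean and [s] the ghost. In - <d, x' - u> = <d, x -
    x'> - <mu, x - u> + <mu - d, x - s> + <mu - d, s - u>, the first term is paid by the movement
    from x to x' and the last by the regret of the ghost. *)
Lemma prox_ball_noisy n (eta h : R) (x x0 g d mu s v u : 'cV[R]_n) :
  0 <= 1 + h -> (1 + h) *: v = x + h *: x0 - eta *: (g + d) -> l2ball u ->
  eta * dot g (ballproj v - u) <=
    (sqn (u - x) - sqn (u - ballproj v)) / 2 +
    h * ((sqn (u - x0) - sqn (u - ballproj v) - sqn (ballproj v - x0)) / 2) +
    (sqn (u - s) - sqn (u - (s - eta *: (mu - d)))) / 2 -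
    eta * dot mu (x - u) + eta * dot (mu - d) (x - s) +
    eta ^+ 2 * (sqn d / 2 + sqn (mu - d) / 2).
Proof.
move=> h0 Ev ub; have := prox_ball h0 Ev ub; move: (ballproj v) => x' H1.
have H2 := euclidean_step (eta *: d) x x'.
have E3 : eta * dot (mu - d) (s - u) =
    (sqn (u - s) - sqn (u - (s - eta *: (mu - d)))) / 2 +
    eta ^+ 2 * (sqn (mu - d) / 2).
  move: (mu - d) => D; rewrite /sqn !dotE.
  by rewrite (dotC u s) (dotC s D) (dotC u D); field.
move: H1 H2 E3; rewrite /sqn !(dotDl g d) !(dotZl eta d) !(dotZr _ eta d).
rewrite !(dotBr _ x x') !(dotBr _ x' u) !(dotBr _ x u) !(dotBr _ s u) !(dotBr _ x s).
rewrite !(dotBl mu d); lra.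
Qed.

(** The same splitting on the simplex, where the mean [mu] of a clipped increment differs from the
    true gradient difference [G] by at most b per coordinate. As |u - y|_1 <= 2, this costs 2 b. The
    factors 2 and 13/4 belong to the ranges |eta d| <= 1 and |eta (mu - d)| <= 2. *)
Lemma prox_simplex_noisy n (eta h b : R) (y y0 g d G mu s v u : 'cV[R]_n) :
  (0 < n)%N -> 0 < eta ->
  (1 + h) *: v = vln y + h *: vln y0 - eta *: (g + d) ->
  simplex u -> psimplex y -> psimplex s ->
  (forall i, `|d i ord0| <= eta^-1) -> (forall i, `|mu i ord0| <= eta^-1) ->
  (forall i, `|(mu - G) i ord0| <= b) ->
  eta * dot g (softmax v - u) <=
    (kl u y - kl u (softmax v)) +
    h * (kl u y0 - kl u (softmax v) - kl (softmax v) y0) +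
    (kl u s - kl u (softmax (vln s - eta *: (mu - d)))) -
    eta * dot G (y - u) + eta * dot (mu - d) (y - s) +
    eta ^+ 2 * (2 * wsq y d + 13 / 4 * wsq s (mu - d)) + eta * (2 * b).
Proof.
move=> n0 eta0 Ev us py ps d1 mu1 Gb.
have u1 : vsum u = 1 by case/simplexE: us.
have := prox_simplex n0 Ev u1.
have py' := softmax_psimplex v n0.
move: (softmax v) py' => y' py' H1.
have H2 : dot (eta *: d) (y - y') - kl y' y <= 2 * wsq y (eta *: d).
  apply: (entropic_step (b := 1)) => //; first exact: expR_le_sqr.
    exact: psimplexW.
  move=> i; rewrite mxE normrM gtr0_norm// mulrC -ler_pdivlMr// mul1r.
  exact: d1.
have E3 : (1 + 0) *: (vln s - eta *: (mu - d)) =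
    vln s + 0 *: vln s - eta *: (mu - d).
  by rewrite addr0 scale1r scale0r addr0.
have := prox_simplex n0 E3 u1.
have ps' := softmax_psimplex (vln s - eta *: (mu - d)) n0.
move: (softmax _) ps' => s' ps' H3.
have H4 : dot (eta *: (mu - d)) (s - s') - kl s' s <= 13 / 4 * wsq s (eta *: (mu - d)).
  apply: (entropic_step (b := 2)) => //; first exact: expR_le_sqr2.
    exact: psimplexW.
  move=> i; rewrite mxE normrM gtr0_norm// mulrC -ler_pdivlMr// !mxE.
  by apply: (le_trans (ler_normB _ _)); have := d1 i; have := mu1 i; lra.
have H5 : dot (mu - G) (u - y) <= b * 2.
  apply: (le_trans (holder _ Gb)); apply: ler_wpM2l.
    have := Gb (Ordinal n0); apply: le_trans; exact: normr_ge0.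
  by apply: l1normB_simplex => //; exact: psimplexW.
have {}H5 : eta * dot (mu - G) (u - y) <= eta * (b * 2) by rewrite ler_pM2l.
move: H1 H2 H3 H4 H5; rewrite !wsqZ !(dotDl g d) !(dotZl eta).
rewrite !(dotBr _ y y') !(dotBr _ y' u) !(dotBr _ y u) !(dotBr _ y s).
rewrite !(dotBr _ s s') !(dotBr _ s' u) !(dotBr _ u y).
rewrite !(dotBl mu G) !(dotBl mu d); lra.
Qed.

(** * Moments of finitely supported random vectors *)

Section Moments.
Variables (I : finType) (p : I -> R).
Hypotheses (p_ge0 : forall i, 0 <= p i) (p_sum : \sum_i p i = 1).

Lemma mean_dot n (xi : I -> 'cV[R]_n) (v : 'cV[R]_n) :
  \sum_i p i * dot (\sum_j p j *: xi j - xi i) v = 0.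
Proof.
rewrite (eq_bigr (fun i => p i * dot (\sum_j p j *: xi j) v - dot (p i *: xi i) v)).
  by rewrite sumrB -mulr_suml p_sum mul1r -dot_suml subrr.
by move=> i _; rewrite dotBl mulrBr dotZl.
Qed.

Lemma variance_le (a : I -> R) :
  \sum_i p i * (\sum_j p j * a j - a i) ^+ 2 <= \sum_i p i * a i ^+ 2.
Proof.
set M := \sum_j p j * a j.
rewrite (eq_bigr (fun i => p i * M ^+ 2 - 2 * M * (p i * a i) + p i * a i ^+ 2)).
  rewrite big_split sumrB -mulr_suml p_sum -mulr_sumr -/M /=.
  by have := sqr_ge0 M; nra.
by move=> i _; ring.
Qed.

Lemma wsq_variance n (y : 'cV[R]_n) (xi : I -> 'cV[R]_n) :
  (forall k, 0 <= y k ord0) ->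
  \sum_i p i * wsq y (\sum_j p j *: xi j - xi i) <= \sum_i p i * wsq y (xi i).
Proof.
move=> y0; have E (z : I -> 'cV[R]_n) : \sum_i p i * wsq y (z i) =
    \sum_k y k ord0 * \sum_i p i * z i k ord0 ^+ 2.
  under eq_bigr do rewrite mulr_sumr; rewrite exchange_big /=.
  by apply: eq_bigr => k _; rewrite mulr_sumr; apply: eq_bigr => i _; rewrite mulrCA.
rewrite !E; apply: ler_sum => k _; apply: ler_wpM2l => //.
apply: le_trans (variance_le (fun i => xi i k ord0)).
rewrite le_eqVlt; apply/orP; left; apply/eqP; apply: eq_bigr => i _.
by rewrite !mxE summxE; congr (_ * (_ - _) ^+ 2); apply: eq_bigr => j _; rewrite mxE.
Qed.

Lemma wsq_mean_le n (y : 'cV[R]_n) (xi : I -> 'cV[R]_n) M : simplex y ->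
  (forall k, \sum_i p i * xi i k ord0 ^+ 2 <= M) ->
  \sum_i p i * wsq y (xi i) <= M.
Proof.
move=> /simplexE[y0 y1] HM; under eq_bigr do rewrite mulr_sumr.
rewrite exchange_big /= -[M]mulr1 -y1 mulr_sumr; apply: ler_sum => k _.
rewrite (eq_bigr (fun i => y k ord0 * (p i * xi i k ord0 ^+ 2))).
  by rewrite -mulr_sumr mulrC ler_wpM2r.
by move=> i _; rewrite mulrCA.
Qed.

Lemma sqn_variance n (xi : I -> 'cV[R]_n) :
  \sum_i p i * sqn (\sum_j p j *: xi j - xi i) <= \sum_i p i * sqn (xi i).
Proof.
have E (z : 'cV[R]_n) : sqn z = wsq (const_mx 1) z.
  by apply: eq_bigr => i _; rewrite mxE mul1r expr2.
under eq_bigr do rewrite E; under [leRHS]eq_bigr do rewrite E.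
by apply: wsq_variance => k; rewrite mxE.
Qed.

Lemma mean_le (a : I -> R) M : (forall i, `|a i| <= M) -> `|\sum_i p i * a i| <= M.
Proof.
move=> aM; apply: (le_trans (ler_norm_sum _ _ _)).
rewrite -[M]mul1r -p_sum mulr_suml; apply: ler_sum => i _.
by rewrite normrM ger0_norm// ler_wpM2l.
Qed.

End Moments.

Context (m n : nat) (A : 'M[R]_(m, n)) (m_gt0 : (0 < m)%N).
Let L := l2inf_norm A.
Let pt := @point R m n.
Implicit Types (w s u S z : pt) (r : pt * pt).

(* V_w(u) *)
Definition breg w u : R := sqn (u.1 - w.1) / 2 + kl u.2 w.2.

(* <g(S), S - u>, which is linear in S because <g(S), S> = 0 *)
Definition payoff S u : R := dot u.2 (A *m S.1) - dot S.2 (A *m u.1).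

(* <g(w) - g(z), w - u> *)
Definition cross z w u : R :=
  dot (A^T *m (w.2 - z.2)) (w.1 - u.1) + dot (- (A *m (w.1 - z.1))) (w.2 - u.2).

Definition feasible u : Prop := l2ball u.1 /\ simplex u.2.
Definition interior w : Prop := l2ball w.1 /\ psimplex w.2.

Lemma interiorW w : interior w -> feasible w.
Proof. by move=> [? /psimplexW]. Qed.

Lemma breg_ge0 w u : psimplex w.2 -> feasible u -> 0 <= breg w u.
Proof.
move=> pw [_ su]; rewrite addr_ge0 ?divr_ge0 ?sqn_ge0//; exact: kl_ge0.
Qed.

Lemma payoffD S S' u : payoff (S.1 + S'.1, S.2 + S'.2) u = payoff S u + payoff S' u.
Proof. by rewrite /payoff /= mulmxDr !dotE; ring. Qed.

Lemma payoffZ c S u : payoff (c *: S.1, c *: S.2) u = c * payoff S u.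
Proof. by rewrite /payoff /= -scalemxAr !dotE; ring. Qed.

Lemma payoff_cross z w u :
  payoff w u = dot (grad A z).1 (w.1 - u.1) + dot (grad A z).2 (w.2 - u.2) +
    cross z w u.
Proof.
rewrite /payoff /cross /grad /= !dot_mulmx !mulmxBr !dotE.
rewrite !(dotC (A *m _)); ring.
Qed.

Variables (eta h alpha : R) (T : nat).
Hypotheses (eta_gt0 : 0 < eta) (hE : h = 12 * (eta * L) ^+ 2).
Hypotheses (alphaE : 2 * h = eta * alpha) (T_large : 2 <= h * T%:R).

Let tau := eta^-1.
Let h_ge0 : 0 <= h. Proof. by rewrite hE mulr_ge0 ?sqr_ge0. Qed.

(** Each bilinear term couples a distance from w to u with one from z to w. Young's inequality and
    [pinsker4] turn the former into V_w(u) and the latter into 2 (eta L)^2 V_z(w), which is below h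
    V_z(w). *)
Lemma cross_le z w u : interior z -> interior w -> feasible u ->
  eta * cross z w u <= breg w u + h * breg z w.
Proof.
move=> [_ pz] [_ pw] [_ su].
have c1 : dot (A^T *m (w.2 - z.2)) (w.1 - u.1) <=
    L * l2norm (u.1 - w.1) * l1norm (w.2 - z.2).
  rewrite dot_mulmx -[u.1 - w.1]opprB -[in l2norm _]scaleN1r l2normZ normrN1 mul1r.
  exact: dot_mulmx_le.
have c2 : dot (- (A *m (w.1 - z.1))) (w.2 - u.2) <=
    L * l2norm (w.1 - z.1) * l1norm (u.2 - w.2).
  rewrite dotNl -dotNr opprB dotC; exact: dot_mulmx_le.
have p1 := pinsker4 (psimplexW pw) pz.
have p2 := pinsker4 su pw.
have h0 := h_ge0.
rewrite /cross /breg -!l2norm_sqr.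
move: c1 c2 p1 p2.
move: (dot _ _) (dot _ _) (l2norm _) (l1norm _) (l2norm _) (l1norm _) (kl _ _) (kl _ _).
move=> Y X c d a b k2 k1 HX HY H1 H2.
have : eta * (X + Y) <= eta * (L * a * b + L * c * d) by rewrite ler_pM2l// lerD.
have HK : h * b ^+ 2 <= h * (4 * k1) by apply: ler_wpM2l.
have S1 := sqr_ge0 (a - eta * L * b).
have S2 := sqr_ge0 (d / 2 - eta * L * c).
have B0 : 0 <= (eta * L) ^+ 2 * b ^+ 2 by rewrite mulr_ge0 ?sqr_ge0.
have C0 : 0 <= (eta * L) ^+ 2 * c ^+ 2 by rewrite mulr_ge0 ?sqr_ge0.
rewrite hE in HK *; lra.
Qed.

(* [s] are the ghost iterates; everything is multiplied by eta. *)
Definition potential z t w S s u : R :=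
  eta * payoff S u + breg w u - eta * cross z w u + breg s u
  - h * t%:R * breg z u + h * breg z w - 2 * breg z u.

(** The ball component is left unprojected, so that its regret is an exact identity. *)
Definition ghost_next s (mu d : pt) : pt :=
  (s.1 - eta *: (mu.1 - d.1), softmax (vln s.2 - eta *: (mu.2 - d.2))).

(** This term and [noiseY] each involve only one of the two independent increments, so the double
    average of their sum separates. *)
Definition noiseX (w s mu d : pt) : R :=
  eta * dot (mu.1 - d.1) (w.1 - s.1) + eta ^+ 2 * (sqn d.1 / 2 + sqn (mu.1 - d.1) / 2).
Definition noiseY (w s mu d : pt) : R :=
  eta * dot (mu.2 - d.2) (w.2 - s.2) +
  eta ^+ 2 * (2 * wsq w.2 d.2 + 13 / 4 * wsq s.2 (mu.2 - d.2)).

(** The payoff charged is that of the new point w', equal to <g(z), w' - u> plus the cross term at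
    w', while the mean of the increment supplies the cross term at w; the - eta cross of the
    potential makes the difference telescope. The h V_z(w) stored on arriving at w pays the noise of
    leaving it. *)
Lemma potential_step b z t w S s (mu d : pt) u :
  interior z -> interior w -> psimplex s.2 -> feasible u ->
  mu.1 = A^T *m (w.2 - z.2) ->
  (forall i, `|d.2 i ord0| <= tau) -> (forall i, `|mu.2 i ord0| <= tau) ->
  (forall i, `|(mu.2 + A *m (w.1 - z.1)) i ord0| <= b) ->
  potential z t.+1 (inner_next eta h z (grad A z) (w, S) d.1 d.2).1
    (inner_next eta h z (grad A z) (w, S) d.1 d.2).2 (ghost_next s mu d) u <=
  potential z t w S s u
    + (noiseX w s mu d + (noiseY w s mu d + eta * (2 * b) - h * breg z w)).
Proof.
move=> iz iw ps [bu su] mu1 d1 mu2 bias.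
have h0 := h_ge0; have h1 : 1 + h != 0 by rewrite gt_eqF//; lra.
set vx := (1 + h)^-1 *: (w.1 + h *: z.1 - eta *: ((grad A z).1 + d.1)).
set vy := (1 + h)^-1 *: (vln w.2 + h *: vln z.2 - eta *: ((grad A z).2 + d.2)).
have Evx : (1 + h) *: vx = w.1 + h *: z.1 - eta *: ((grad A z).1 + d.1).
  by rewrite scalerA mulfV// scale1r.
have Evy : (1 + h) *: vy = vln w.2 + h *: vln z.2 - eta *: ((grad A z).2 + d.2).
  by rewrite scalerA mulfV// scale1r.
have h10 : 0 <= 1 + h by lra.
have HX := prox_ball_noisy mu.1 s.1 h10 Evx bu.
have := @prox_simplex_noisy _ eta h b w.2 z.2 (grad A z).2 d.2
  (- (A *m (w.1 - z.1))) mu.2 s.2 vy u.2 m_gt0 eta_gt0 Evy su iw.2 ps d1 mu2.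
rewrite opprK => /(_ bias) HY.
have -> : inner_next eta h z (grad A z) (w, S) d.1 d.2 =
    ((ballproj vx, softmax vy), (S.1 + ballproj vx, S.2 + softmax vy)) by [].
(* The contraction term - h V_{w'}(u) of the proximal step is discarded. *)
have fw' : 0 <= breg (ballproj vx, softmax vy) u.
  by apply: breg_ge0 => //; exact: softmax_psimplex.
have hV := mulr_ge0 h0 fw'.
rewrite /potential /=.
rewrite (payoffD S (ballproj vx, softmax vy)) (payoff_cross z (ballproj vx, softmax vy)).
have -> : eta * cross z w u = eta * dot mu.1 (w.1 - u.1)
    + eta * dot (- (A *m (w.1 - z.1))) (w.2 - u.2).
  by rewrite /cross mu1 mulrDr.
rewrite /noiseX /noiseY /ghost_next.
move: HX HY hV; rewrite /breg /= -natr1.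
do !move: (cross _ _ _) => ?; do !move: (payoff _ _) => ?.
do !move: (sqn _) => ?; do !move: (kl _ _) => ?.
do !move: (dot _ _) => ?; do !move: (wsq _ _) => ?.
lra.
Qed.

Let inner z := inner_step (sparse_of A) tau eta h (1 + h)^-1 z (grad A z).

Lemma interior_next z g r dx dy : interior (inner_next eta h z g r dx dy).1.
Proof. by split; [exact: ballproj_ball|exact: softmax_psimplex]. Qed.

(** Backward induction with k steps left. The bound is affine in [c], so averaging over the sampled
    indices only averages the amounts added to [c], and those are at most 0 in the mean. The scale
    [kappa] leaves room for the final division by K. *)
Lemma inner_rule_aux kappa z F c0 : 0 < kappa -> interior z ->
  (forall r c, (forall u, feasible u ->
      payoff (T%:R^-1 *: r.2.1, T%:R^-1 *: r.2.2) u - alpha * breg z u <= c) ->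
    fle (F r) (c0 + c / kappa)) ->
  forall k t w S s c, (t + k = T)%N -> interior w -> psimplex s.2 ->
  (forall u, feasible u -> potential z t w S s u <= c) ->
  fle (expect (iterp k (inner z) (w, S)) F) (c0 + c / (kappa * (eta * T%:R))).
Proof.
move=> k0 iz HF; have T0 : 0 < T%:R :> R.
  rewrite ltr0n lt0n; apply/negP => /eqP T0; move: T_large; rewrite T0; lra.
have eT0 : 0 < eta * T%:R by rewrite mulr_gt0.
set D := kappa * (eta * T%:R); have eT : 0 < D by rewrite mulr_gt0.
elim=> [|k IH] t w S s c tk iw ps Hc /=.
  have -> : c / D = c / (eta * T%:R) / kappa by rewrite /D invfM mulrA mulrAC.
  apply: HF => u fu /=; rewrite payoffZ ler_pdivlMr//.
  have -> : (T%:R^-1 * payoff S u - alpha * breg z u) * (eta * T%:R) =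
    eta * payoff S u - 2 * h * T%:R * breg z u.
    by rewrite alphaE; field; rewrite gt_eqF.
  apply: le_trans (Hc u fu); rewrite /potential.
  have -> : t = T by rewrite -tk addn0.
  (* The last cross term is paid by V_w(u) and h V_z(w), and h T >= 2 settles the term 2 V_z(u). *)
  have := cross_le iz iw fu; have := breg_ge0 ps fu.
  have bz := breg_ge0 iz.2 fu; have := ler_wpM2r bz T_large.
  by lra.
rewrite expect_bind expect_inner /=.
have [I [p [xi [[p0 p1] pm p2 HX]]]] := incX_spec A w.2 z.2.
have tau0 : 0 < tau by rewrite invr_gt0.
have [J [q [ze [[q0 q1] zeb qm q2 HY]]]] := incY_spec A w.1 z.1 tau0.
pose mu : pt := (\sum_i p i *: xi i, \sum_j q j *: ze j).
pose b := L ^+ 2 * sqn (w.1 - z.1) / (4 * tau).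
pose d i j : pt := (xi i, ze j).
have muy k' : mu.2 k' ord0 = \sum_j q j * ze j k' ord0.
  by rewrite summxE; apply: eq_bigr => j _; rewrite mxE.
pose N i j := noiseX w s mu (d i j) + (noiseY w s mu (d i j) + eta * (2 * b) - h * breg z w).
have step i j : fle (expect (iterp k (inner z)
      (inner_next eta h z (grad A z) (w, S) (xi i) (ze j))) F)
    (c0 + (c + N i j) / D).
  have := interior_next z (grad A z) (w, S) (xi i) (ze j).
  have : forall u, feasible u ->
      potential z t.+1 (inner_next eta h z (grad A z) (w, S) (xi i) (ze j)).1
        (inner_next eta h z (grad A z) (w, S) (xi i) (ze j)).2
        (ghost_next s mu (d i j)) u <= c + N i j.
    move=> u fu; apply: (@le_trans _ _ (potential z t w S s u + N i j)); last first.
      by rewrite lerD2r Hc.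
    apply: (@potential_step b z t w S s mu (d i j) u iz iw ps fu pm (zeb j)).
    - by move=> k'; rewrite muy; exact: mean_le.
    - by move=> k'; rewrite mxE muy; exact: qm.
  move: (inner_next _ _ _ _ _ _ _) => [w' S'] HP iw'.
  by apply: (IH t.+1 w' S' (ghost_next s mu (d i j))) => //;
    [rewrite addSnnS|exact: (softmax_psimplex _ m_gt0)].
apply: fleW; first by apply: HX => i; apply: HY => j; exact: step.
have py := psimplexW iw.2.
have affine (K : finType) (r : K -> R) (f : K -> R) a e : \sum_i r i = 1 ->
    \sum_i r i * (a + e * f i) = a + e * \sum_i r i * f i.
  move=> r1; under eq_bigr do rewrite mulrDr; rewrite big_split /= -mulr_suml r1 mul1r.
  by rewrite mulr_sumr; congr (_ + _); apply: eq_bigr => i _; rewrite mulrCA.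
pose NX := \sum_i p i * noiseX w s mu (xi i, 0).
pose NY := \sum_j q j * noiseY w s mu (0, ze j).
have eT' := gt_eqF eT.
have -> : \sum_i p i * (\sum_j q j * (c0 + (c + N i j) / D)) =
    c0 + (c + (NX + NY + eta * (2 * b) - h * breg z w)) / D.
  rewrite (eq_bigr (fun i => p i * ((c0 + (c + (NY + eta * (2 * b)
     - h * breg z w)) / D) +
     D^-1 * noiseX w s mu (xi i, 0)))); last first.
    move=> i _; congr (_ * _).
    rewrite (eq_bigr (fun j => q j * ((c0 + (c + (noiseX w s mu (xi i, 0) +
       eta * (2 * b) - h * breg z w)) / D) +
       D^-1 * noiseY w s mu (0, ze j)))); last first.
      move=> j _; congr (_ * _); rewrite /N -[noiseX _ _ _ (d i j)]/(noiseX w s mu (xi i, 0)).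
      by rewrite -[noiseY _ _ _ (d i j)]/(noiseY w s mu (0, ze j)); ring.
    by rewrite affine// -/NY; ring.
  by rewrite affine// -/NX; ring.
(* The linear term has mean zero because w and s were fixed before sampling. With 21/4 = 2 + 13/4,
   both local norms are bounded by the same second moment. *)
have EY : NY <= eta ^+ 2 * (21 / 4 * (L ^+ 2 * sqn (w.1 - z.1))).
  rewrite /NY (eq_bigr (fun j => eta * (q j * dot (mu.2 - ze j) (w.2 - s.2)) +
    eta ^+ 2 * (2 * (q j * wsq w.2 (ze j)) + 13 / 4 * (q j * wsq s.2 (mu.2 - ze j))))).
    rewrite big_split /= -!mulr_sumr mean_dot// mulr0 add0r big_split /= -!mulr_sumr.
    rewrite ler_wpM2l ?sqr_ge0//.
    have H1 := wsq_mean_le py q2.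
    have H2 := wsq_mean_le (psimplexW ps) q2.
    have s0 k' : 0 <= s.2 k' ord0 by apply: ltW; exact: ps.1.
    have H3 := wsq_variance q1 ze s0.
    by rewrite /=; move: H1 H2 H3; rewrite -/L; lra.
  by move=> j _; rewrite /noiseY /=; ring.
(* The increment and its centred version each contribute half the second moment; Pinsker then turns
   the squared l1 distance into 4 KL. *)
have EX : NX <= eta ^+ 2 * (L ^+ 2 * (4 * kl w.2 z.2)).
  rewrite /NX (eq_bigr (fun i => eta * (p i * dot (mu.1 - xi i) (w.1 - s.1)) +
    eta ^+ 2 * (p i * sqn (xi i) / 2 + p i * sqn (mu.1 - xi i) / 2))).
    rewrite big_split /= -!mulr_sumr mean_dot// mulr0 add0r big_split /= -!mulr_suml.
    rewrite ler_wpM2l ?sqr_ge0//.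
    have H1 := sqn_variance p1 xi.
    have H2 := ler_wpM2l (sqr_ge0 L) (pinsker4 py iz.2).
    by rewrite /=; move: H1 H2 p2; rewrite -/L; lra.
  by move=> i _; rewrite /noiseX /=; ring.
rewrite lerD2l ler_pM2r ?invr_gt0// gerDl.
have -> : eta * (2 * b) = eta ^+ 2 * (L ^+ 2 * sqn (w.1 - z.1) / 2).
  by rewrite /b /tau; field; rewrite gt_eqF.
have kp := kl_ge0 py iz.2; have sp := sqn_ge0 (w.1 - z.1).
have B1 : 0 <= eta ^+ 2 * L ^+ 2 * kl w.2 z.2 by rewrite mulr_ge0 // mulr_ge0 // sqr_ge0.
have B2 : 0 <= eta ^+ 2 * L ^+ 2 * sqn (w.1 - z.1) by rewrite mulr_ge0 // mulr_ge0 // sqr_ge0.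
rewrite hE /breg; lra.
Qed.

(** The inner guarantee for an arbitrary continuation [F], a bound [c] valid for all u standing for
    the maximum. At the start all iterates equal z and the potential is 0. *)
Lemma inner_rule kappa z F c0 : 0 < kappa -> interior z ->
  (forall r c, (forall u, feasible u ->
      payoff (T%:R^-1 *: r.2.1, T%:R^-1 *: r.2.2) u - alpha * breg z u <= c) ->
    fle (F r) (c0 + c / kappa)) ->
  fle (expect (iterp T (inner z) (z, 0)) F) c0.
Proof.
move=> k0 iz HF; rewrite -[c0]addr0 -(mul0r (kappa * (eta * T%:R))^-1).
apply: (inner_rule_aux k0 iz HF (t := 0) (s := z)) => //; first exact: iz.2.
move=> u fu; rewrite /potential /payoff /cross /breg /= !mulmx0 !dot0l !dot0r.
by rewrite !subrr !mulmx0 oppr0 !dot0l /kl !subrr !dot0r /sqn dot0l; lra.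
Qed.

End InnerLoop.

(** * The outer loop and the duality gap *)

Section OuterLoop.
Context {R : realType} (m n : nat) (A : 'M[R]_(m, n)) (m_gt0 : (0 < m)%N).
Let L := l2inf_norm A.
Let pt := @point R m n.
Implicit Types (w u S z : pt) (s r : pt * pt).

Definition mirror (alpha : R) z (hS : pt) : pt :=
  (ballproj (z.1 - alpha^-1 *: (A^T *m hS.2)),
   softmax (vln z.2 + alpha^-1 *: (A *m hS.1))).

(** The last bracket is what the inner loop controls, taken at the mirror point. That point depends
    on the samples, which is why a bound uniform in u is indispensable. *)
Lemma mirror_step alpha z (hS : pt) u : 0 < alpha -> feasible u ->
  payoff A hS u + alpha * breg (mirror alpha z hS) u <=
  alpha * breg z u +
    (payoff A hS (mirror alpha z hS) - alpha * breg z (mirror alpha z hS)).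
Proof.
move=> a0 [bu su]; rewrite /mirror.
have ai : 0 < alpha^-1 by rewrite invr_gt0.
set vx := z.1 - _; set vy := vln z.2 + _.
have Evx : (1 + 0) *: vx = z.1 + 0 *: z.1 - alpha^-1 *: (A^T *m hS.2).
  by rewrite addr0 scale1r scale0r addr0.
have Evy : (1 + 0) *: vy = vln z.2 + 0 *: vln z.2 - alpha^-1 *: (- (A *m hS.1)).
  by rewrite addr0 scale1r scale0r addr0 scalerN opprK.
have h0 : 0 <= 1 + 0 :> R by rewrite addr0.
have := prox_ball h0 Evx bu.
have [_ u1] := (simplexE u.2).1 su.
have := prox_simplex m_gt0 Evy u1.
rewrite !mul0r !addr0; move: (ballproj vx) (softmax vy) => x' y' H1 H2.
set z' : pt := (x', y').
have -> : payoff A hS u = dot (A^T *m hS.2) (z'.1 - u.1) +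
   dot (- (A *m hS.1)) (z'.2 - u.2) + payoff A hS z'.
  rewrite /payoff !dot_mulmx !mulmxBr !dotE.
  by rewrite !(dotC (A *m _)); ring.
rewrite /breg /=.
have {}H1 := congr1 (fun t => alpha * t) H1; rewrite /= mulVKf ?gt_eqF// in H1.
have {}H2 := ler_wpM2l (ltW a0) H2; rewrite mulVKf ?gt_eqF// in H2.
lra.
Qed.

Section OuterRule.
Variables (eta h alpha : R) (T : nat).
Hypotheses (eta_gt0 : 0 < eta) (hE : h = 12 * (eta * L) ^+ 2).
Hypotheses (alphaE : 2 * h = eta * alpha) (T_large : 2 <= h * T%:R).
Hypotheses (alpha_gt0 : 0 < alpha).

Let outer := outer_step (sparse_of A) T alpha eta^-1 eta h (1 + h)^-1.

(** Each outer iteration adds to [c] the excess of its inner loop, whose contribution to the mean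
    [inner_rule] bounds by 0; the final alpha V_z(u) is dropped. *)
Lemma outer_rule kappa F k s c : 0 < kappa -> interior s.1 ->
  (forall r c', (forall u, feasible u -> payoff A r.2 u <= c') ->
    fle (F r) (c' / kappa)) ->
  (forall u, feasible u -> payoff A s.2 u + alpha * breg s.1 u <= c) ->
  fle (expect (iterp k outer s) F) (c / kappa).
Proof.
move=> k0 + HF; elim: k s c => [|k IH] s c iz Hc /=.
  apply: HF => u fu; apply: le_trans (Hc u fu); rewrite lerDl; apply: mulr_ge0; first exact: ltW.
  by apply: breg_ge0 => //; case: iz.
rewrite expect_bind expect_outer.
apply: (inner_rule m_gt0 eta_gt0 hE alphaE T_large k0 iz) => r c' Hr.
rewrite -mulrDl; apply: IH.
  by split; [exact: ballproj_ball|exact: softmax_psimplex].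
move=> u fu.
pose hS : pt := (T%:R^-1 *: r.2.1, T%:R^-1 *: r.2.2).
have fm : feasible (mirror alpha s.1 hS).
  by split; [exact: ballproj_ball|exact/psimplexW/softmax_psimplex].
have := mirror_step s.1 hS alpha_gt0 fu; have := Hr _ fm; have := Hc u fu.
rewrite -[(outer_next _ _ _ _ _).1]/(mirror alpha s.1 hS).
rewrite -[(outer_next _ _ _ _ _).2]/(s.2.1 + hS.1, s.2.2 + hS.2) payoffD.
by rewrite -/hS; lra.
Qed.

End OuterRule.

(** * The gap as the payoff against best responses *)

Lemma sup_max (E : set R) x : E x -> ubound E x -> sup E = x.
Proof.
move=> Ex ux; apply/le_anti/andP; split; first by apply: ge_sup => //; exists x.
by apply: ub_le_sup => //; exists x.
Qed.

Lemma inf_min (E : set R) x : E x -> lbound E x -> inf E = x.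
Proof.
move=> Ex ux; apply/le_anti/andP; split; last by apply: lb_le_inf => //; exists x.
by apply: ge_inf => //; exists x.
Qed.

Lemma ex_argmax (x : 'cV[R]_m) : exists i, forall k, x k ord0 <= x i ord0.
Proof.
exists [arg max_(i > Ordinal m_gt0) x i ord0]%O.
by case: arg_maxP => // i _ H k; exact: H.
Qed.

Lemma explicit_gapE (z : pt) : exists2 i, forall k, (A *m z.1) k ord0 <= (A *m z.1) i ord0
  & explicit_gap A z = (A *m z.1) i ord0 + l2norm (A^T *m z.2).
Proof.
have [i Hi] := ex_argmax (A *m z.1); exists i => //; congr (_ + _).
by apply: sup_max; [exists i|move=> _ [k _ <-]; exact: Hi].
Qed.

Lemma delta_simplex (i : 'I_m) : simplex (delta_mx i ord0 : 'cV[R]_m).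
Proof.
apply/simplexE; split=> [k|]; first by rewrite mxE; case: (_ && _).
rewrite /vsum (bigD1 i)//= mxE !eqxx big1 ?addr0// => k /negbTE ki.
by rewrite mxE ki.
Qed.

Lemma dot_delta (i : 'I_m) (x : 'cV[R]_m) : dot (delta_mx i ord0) x = x i ord0.
Proof.
rewrite /dot (bigD1 i)//= mxE !eqxx mul1r big1 ?addr0// => k /negbTE ki.
by rewrite mxE ki mul0r.
Qed.

Lemma ball_min k (v : 'cV[R]_k) : exists2 x, l2ball x & dot v x = - l2norm v.
Proof.
have [v0|v0] := eqVneq (l2norm v) 0.
  exists 0; first by rewrite /l2ball /= l2normE /sqn dot0l sqrtr0.
  by rewrite dot0r v0 oppr0.
exists (- (l2norm v)^-1 *: v).
  by rewrite /l2ball /= l2normZ normrN ger0_norm ?invr_ge0 ?l2norm_ge0// mulVf.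
by rewrite dotZr -/(sqn v) -l2norm_sqr; field.
Qed.

(** The supremum is attained at a vertex of the simplex and the infimum at minus the normalised
    vector A^T z^y. *)
Lemma duality_gapE (z : pt) : duality_gap A z = explicit_gap A z.
Proof.
have [i Hi ->] := explicit_gapE z; rewrite /duality_gap.
rewrite (@sup_max _ ((A *m z.1) i ord0)); first last.
- move=> _ [y /simplexE[y0 y1] <-]; rewrite bilinE -[leRHS]mulr1 -y1 mulr_sumr.
  by apply: ler_sum => k _; rewrite mulrC ler_wpM2r.
- by exists (delta_mx i ord0); rewrite ?bilinE ?dot_delta//; exact: delta_simplex.
rewrite (@inf_min _ (- l2norm (A^T *m z.2))) ?opprK//.
- have [x bx xE] := ball_min (A^T *m z.2); exists x => //.
  by rewrite bilinE -dot_mulmx.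
- move=> _ [x bx <-]; rewrite bilinE -dot_mulmx lerNl -dotNr.
  apply: (le_trans (cauchy_schwarz _ _)); rewrite -[leRHS]mulr1.
  apply: ler_wpM2l; first exact: l2norm_ge0.
  by rewrite -scaleN1r l2normZ normrN1 mul1r.
Qed.

(** The gap is the payoff at a single feasible u, made of the best responses of both players. *)
Lemma explicit_gap_le (z : pt) c :
  (forall u, feasible u -> payoff A z u <= c) -> explicit_gap A z <= c.
Proof.
move=> Hc; have [i _ ->] := explicit_gapE z.
have [x bx xE] := ball_min (A^T *m z.2).
have := Hc (x, delta_mx i ord0) (conj bx (delta_simplex i)).
by rewrite /payoff /= dot_delta -dot_mulmx xE opprK.
Qed.

(** * Feasibility of the output *)

Section Invariants.

(* The invariant of a sum of k feasible points. *)
Definition multiple (k : nat) S : Prop :=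
  [/\ l2norm S.1 <= k%:R, forall i, 0 <= S.2 i ord0 & vsum S.2 = k%:R].

Lemma multiple0 : multiple 0 0.
Proof.
split=> [|i|]; rewrite ?mxE//; first by rewrite l2normE /sqn dot0l sqrtr0.
by apply: big1 => i _; rewrite mxE.
Qed.

Lemma multipleD k S u : multiple k S -> feasible u ->
  multiple k.+1 (S.1 + u.1, S.2 + u.2).
Proof.
move=> [S1 S2 S3] [u1 /simplexE[u2 u3]]; split=> [|i|] /=.
- by apply: (le_trans (l2normD _ _)); rewrite -natr1 lerD.
- by rewrite mxE addr_ge0.
- by rewrite -natr1 -S3 -u3 -big_split; apply: eq_bigr => i _; rewrite mxE.
Qed.

Lemma multiple_mean k S : (0 < k)%N -> multiple k S ->
  feasible (k%:R^-1 *: S.1, k%:R^-1 *: S.2).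
Proof.
move=> k0 [S1 S2 S3]; have kp : 0 < k%:R :> R by rewrite ltr0n.
split.
  by rewrite /l2ball /= l2normZ gtr0_norm ?invr_gt0// mulrC ler_pdivrMr// mul1r.
apply/simplexE; split=> [i|] /=.
  by rewrite mxE mulr_ge0// invr_ge0 ltW.
rewrite /vsum; under eq_bigr do rewrite mxE; rewrite -mulr_sumr -/(vsum S.2) S3.
by rewrite mulVf// gt_eqF.
Qed.

Variables (T : nat) (alpha tau eta h : R).
Hypothesis T_gt0 : (0 < T)%N.
Let inner z := inner_step (sparse_of A) tau eta h (1 + h)^-1 z (grad A z).
Let outer := outer_step (sparse_of A) T alpha tau eta h (1 + h)^-1.

Lemma always_inner_loop z : interior z ->
  always (iterp T (inner z) (z, 0)) (fun r => multiple T r.2).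
Proof.
move=> iz; pose I t (r : pt * pt) := interior r.1 /\ multiple t r.2.
have := @always_iterp R _ I (inner z) T 0 (z, 0); rewrite addn0 => H w.
apply: (H _ _ w).2; last by split=> //; exact: multiple0.
move=> t [w' S'] [_ mS]; apply: always_inner => dx dy.
have iN := interior_next m_gt0 eta h z (grad A z) (w', S') dx dy.
by split; [exact: iN|exact: multipleD mS (interiorW iN)].
Qed.

Lemma always_outer_loop k s : interior s.1 -> multiple 0 s.2 ->
  always (iterp k outer s) (fun r => multiple k r.2).
Proof.
move=> iz ms; pose I t (r : pt * pt) := interior r.1 /\ multiple t r.2.
have := @always_iterp R _ I outer k 0 s; rewrite addn0 => H w.
apply: (H _ _ w).2 => // t s' [iz' ms'].
apply: (always_outer (always_inner_loop iz')) => r mr; split.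
  by split; [exact: ballproj_ball|exact: softmax_psimplex].
exact: multipleD ms' (multiple_mean T_gt0 mr).
Qed.

End Invariants.

End OuterLoop.

(** * Operation counts *)

Section Costs.
Context {R : realType}.

Lemma cost_tabulate n (f : 'I_n -> prog R R) (c : 'I_n -> nat) :
  (forall i, cost_le (f i) (c i)) -> cost_le (tabulate f) (\sum_i c i)%N.
Proof.
elim: n f c => [|n IH] f c fc /=; first exact: cost_ret.
rewrite big_ord_recl; apply: cost_bind (fc _) _ => v.
rewrite -[X in cost_le _ X]addn0.
apply: cost_bind (IH _ (fun i => c (lift ord0 i)) _) _ => [i|g]; first exact: fc.
exact: cost_ret.
Qed.

Lemma cost_vec n (f : 'I_n -> prog R R) (c : 'I_n -> nat) :
  (forall i, cost_le (f i) (c i)) -> cost_le (vec f) (\sum_i c i)%N.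
Proof.
move=> fc; rewrite -[X in cost_le _ X]addn0; apply: cost_bind (cost_tabulate fc) _ => g.
exact: cost_ret.
Qed.

Lemma cost_vmap n (f : R -> prog R R) (x : 'cV[R]_n) c :
  (forall a, cost_le (f a) c) -> cost_le (vmap f x) (n * c)%N.
Proof.
move=> fc; have := @cost_vec n (fun i => f (x i ord0)) (fun=> c) (fun i => fc _).
by rewrite sum_nat_const card_ord.
Qed.

Lemma cost_vmap2 n (f : R -> R -> prog R R) (x y : 'cV[R]_n) c :
  (forall a b, cost_le (f a b) c) -> cost_le (vmap2 f x y) (n * c)%N.
Proof.
move=> fc.
have := @cost_vec n (fun i => f (x i ord0) (y i ord0)) (fun=> c) (fun i => fc _ _).
by rewrite sum_nat_const card_ord.
Qed.

Lemma cost_vadd n (x y : 'cV[R]_n) : cost_le (vadd x y) n.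
Proof. by rewrite -[X in cost_le _ X]muln1; exact: cost_vmap2. Qed.
Lemma cost_vsub n (x y : 'cV[R]_n) : cost_le (vsub x y) n.
Proof. by rewrite -[X in cost_le _ X]muln1; exact: cost_vmap2. Qed.
Lemma cost_vscale n c (x : 'cV[R]_n) : cost_le (vscale c x) n.
Proof. by rewrite -[X in cost_le _ X]muln1; exact: cost_vmap. Qed.
Lemma cost_vdiv n c (x : 'cV[R]_n) : cost_le (vmap (fun a => pdiv a c) x) n.
Proof. by rewrite -[X in cost_le _ X]muln1; exact: cost_vmap. Qed.
Lemma cost_vlog n (x : 'cV[R]_n) : cost_le (vmap plog x) n.
Proof. by rewrite -[X in cost_le _ X]muln1; exact: cost_vmap. Qed.
Lemma cost_vexp n (x : 'cV[R]_n) : cost_le (vmap pexp x) n.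
Proof. by rewrite -[X in cost_le _ X]muln1; exact: cost_vmap. Qed.
Lemma cost_vneg n (x : 'cV[R]_n) : cost_le (vneg x) (n * 2).
Proof. exact: cost_vmap. Qed.

Lemma cost_psum (s : seq R) : cost_le (psum s) (size s).+1.
Proof.
elim: s => [|x s IH] //=; apply: cost_leW (cost_bind IH (c := 1%N) _) _ => //.
by rewrite addn1.
Qed.

Lemma cost_pmaxs (s : seq R) : cost_le (pmaxs s) (size s).+1.
Proof.
elim: s => [|x s IH] //=; apply: cost_leW (cost_bind IH (c := 1%N) _) _ => //.
by rewrite addn1.
Qed.

Lemma size_entries n (x : 'cV[R]_n) : size (entries x) = n.
Proof. by rewrite size_map -cardE card_ord. Qed.

Lemma cost_psum_entries n (x : 'cV[R]_n) : cost_le (psum (entries x)) n.+1.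
Proof. by rewrite -[X in X.+1](size_entries x); exact: cost_psum. Qed.

Lemma cost_pmaxs_entries n (x : 'cV[R]_n) : cost_le (pmaxs (entries x)) n.+1.
Proof. by rewrite -[X in X.+1](size_entries x); exact: cost_pmaxs. Qed.

Lemma cost_vnorm1 n (x : 'cV[R]_n) : cost_le (vnorm1 x) (4 * n + 1).
Proof.
have H := cost_bind (@cost_vmap n pabs x 3 (fun a w => leqnn _)) (@cost_psum_entries n).
by apply: cost_leW H _; lia.
Qed.

Lemma cost_vnorm2 n (x : 'cV[R]_n) : cost_le (vnorm2 x) (2 * n + 2).
Proof.
have H : cost_le (vnorm2 x) (n * 1 + (n.+1 + 1)).
  apply: cost_bind => [|a]; first exact: cost_vmap.
  by apply: cost_bind => [|s] //; exact: cost_psum_entries.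
by apply: cost_leW H _; lia.
Qed.

Lemma cost_sdot n (s : seq ('I_n * R)) x : cost_le (sdot s x) (2 * size s + 1).
Proof.
elim: s => [|[j a] s IH] //=; apply: cost_leW (cost_bind IH (c := 2%N) _) _ => //.
by lia.
Qed.

Lemma cost_snorm2 n (s : seq ('I_n * R)) : cost_le (snorm2 s) (2 * size s + 2).
Proof.
have H : cost_le (ssqr s) (2 * size s + 1).
  elim: s => [|[j a] s IH] //=; apply: cost_leW (cost_bind IH (c := 2%N) _) _ => //.
  by lia.
by apply: cost_leW (cost_bind H (c := 1%N) _) _ => //; lia.
Qed.

Lemma cost_projX n (v : 'cV[R]_n) : cost_le (projX v) (3 * n + 4).
Proof.
have H : cost_le (projX v) ((2 * n + 2) + (1 + (1 + n))).
  apply: cost_bind => [|r]; first exact: cost_vnorm2.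
  by do 2!apply: cost_bind => // ?; exact: cost_vdiv.
by apply: cost_leW H _; lia.
Qed.

Lemma cost_projY n (v : 'cV[R]_n) : cost_le (projY v) (6 * n + 1).
Proof.
have H : cost_le (projY v) (n + ((4 * n + 1) + n)).
  apply: cost_bind => [|e]; first exact: cost_vexp.
  by apply: cost_bind => [|s]; [exact: cost_vnorm1|exact: cost_vdiv].
by apply: cost_leW H _; lia.
Qed.

Lemma cost_clip n tau (v : 'cV[R]_n) : cost_le (clip tau v) (2 * n + 2).
Proof.
have H : cost_le (clip tau v) (2 + n * 2).
  by apply: cost_bind => [//|t]; apply: cost_vmap.
by apply: cost_leW H _; lia.
Qed.

Lemma cost_if (B : Type) (b : bool) (p q : prog R B) c :
  cost_le p c -> cost_le q c -> cost_le (if b then p else q) c.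
Proof. by case: b. Qed.

Lemma cost_sample n (p : 'cV[R]_n) : cost_le (sample p) (2 * n + 2).
Proof.
have H u : forall s acc, cost_le (invert p u acc s) (2 * size s).
  elim=> [|i s IH] acc; first exact: cost_ret.
  apply: (@cost_leW _ _ (acc' <~ padd acc (p i ord0);; b <~ pless u acc';;
    if b then Ret (Some i) else invert p u acc' s) (1 + (1 + 2 * size s))); last first.
    by rewrite /=; lia.
  by do 2!apply: cost_bind => // ?; apply: cost_if => //; exact: cost_ret.
have H' : cost_le (sample p) (1 + (1 + 2 * size (enum 'I_n))).
  by do 2!apply: cost_bind => // ?; exact: H.
by apply: cost_leW H' _; rewrite -cardE card_ord; lia.
Qed.

Section Matrix.
Context (m n : nat) (A : sparse R m n).

Lemma cost_incX y y0 : cost_le (incX A y y0) (11 * m + n + 6).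
Proof.
have H : cost_le (incX A y y0) (m + ((4 * m + 1) + (1 + (1 +
    (m * 4 + ((2 * m + 2) + (1 + n))))))).
  apply: cost_bind => [|d]; first exact: cost_vsub.
  apply: cost_bind => [|s]; first exact: cost_vnorm1.
  apply: cost_bind => // z; apply: cost_bind => // b; apply: cost_if; last exact: cost_ret.
  apply: cost_bind => [|p]; first by apply: cost_vmap => a w.
  apply: cost_bind => [|[i|]]; [exact: cost_sample| |exact: cost_ret].
  by apply: cost_bind => // c; exact: cost_vscale.
by apply: cost_leW H _; lia.
Qed.

Lemma cost_incY tau x x0 : cost_le (incY A tau x x0) (7 * n + 5 * m + 10).
Proof.
have H : cost_le (incY A tau x x0) (n + ((2 * n + 2) + (1 + (1 + (1 +
    (n * 2 + ((2 * n + 2) + (1 + (m + ((2 * m + 2) + m * 2)))))))))).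
  apply: cost_bind => [|d]; first exact: cost_vsub.
  apply: cost_bind => [|s]; first exact: cost_vnorm2.
  apply: cost_bind => // z; apply: cost_bind => // b; apply: cost_if; last exact: cost_ret.
  apply: cost_bind => // s2.
  apply: cost_bind => [|p]; first by apply: cost_vmap => a w.
  apply: cost_bind => [|[i|]]; [exact: cost_sample| |exact: cost_ret].
  apply: cost_bind => // c; apply: cost_bind => [|v]; first exact: cost_vscale.
  by apply: cost_bind => [|w]; [exact: cost_clip|exact: cost_vneg].
by apply: cost_leW H _; lia.
Qed.

Lemma cost_combine k (w h eta : R) (u u0 g : 'cV[R]_k) :
  cost_le (combine w h eta u u0 g) (5 * k).
Proof.
have H : cost_le (combine w h eta u u0 g) (k + (k + (k + (k + k)))).
  apply: cost_bind => [|a]; first exact: cost_vscale.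
  apply: cost_bind => [|b]; first exact: cost_vadd.
  apply: cost_bind => [|c]; first exact: cost_vscale.
  by apply: cost_bind => [|d]; [exact: cost_vsub|exact: cost_vscale].
by apply: cost_leW H _; lia.
Qed.

Lemma cost_inner (tau eta h w : R) z0 g0 s :
  cost_le (inner_step A tau eta h w z0 g0 s) (31 * m + 18 * n + 21).
Proof.
case: z0 g0 s => [x0 y0] [g0x g0y] [[x y] [sx sy]].
apply: (@cost_leW _ _ _ ((11 * m + n + 6) + ((7 * n + 5 * m + 10) + (n + (m +
  (5 * n + ((3 * n + 4) + (m + (m + (5 * m + ((6 * m + 1) + (n + (m + 0)))))))))))));
  last by lia.
apply: cost_bind => [|dx]; first exact: cost_incX.
apply: cost_bind => [|dy]; first exact: cost_incY.
apply: cost_bind => [|gx]; first exact: cost_vadd.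
apply: cost_bind => [|gy]; first exact: cost_vadd.
apply: cost_bind => [|vx]; first exact: cost_combine.
apply: cost_bind => [|x']; first exact: cost_projX.
apply: cost_bind => [|ly]; first exact: cost_vlog.
apply: cost_bind => [|ly0]; first exact: cost_vlog.
apply: cost_bind => [|vy]; first exact: cost_combine.
apply: cost_bind => [|y']; first exact: cost_projY.
apply: cost_bind => [|sx']; first exact: cost_vadd.
by apply: cost_bind => [|sy']; [exact: cost_vadd|exact: cost_ret].
Qed.

End Matrix.

Section Dense.
Context (m n : nat) (A : 'M[R]_(m, n)).
Let Z := nnz A.

Lemma nnz_rows : (\sum_i size (srow (sparse_of A) i) = Z)%N.
Proof.
rewrite /Z /nnz cardsE -sum1_card.
rewrite -(pair_big_dep xpredT (fun i j => A i j != 0) (fun _ _ => 1%N)) /=.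
apply: eq_bigr => i _; by rewrite size_map size_filter -sum1_count big_enum_cond.
Qed.

Lemma nnz_cols : (\sum_j size (scol (sparse_of A) j) = Z)%N.
Proof.
rewrite /Z /nnz cardsE -sum1_card.
rewrite -(pair_big_dep xpredT (fun i j => A i j != 0) (fun _ _ => 1%N)) /=.
rewrite (exchange_big_dep xpredT) //=; apply: eq_bigr => j _.
by rewrite size_map size_filter -sum1_count big_enum_cond.
Qed.

Lemma cost_mulv x : cost_le (mulv (sparse_of A) x) (2 * Z + m).
Proof.
apply: cost_leW; first by apply: cost_vec => i; exact: cost_sdot.
by rewrite big_split /= -big_distrr /= nnz_rows sum_nat_const card_ord muln1.
Qed.

Lemma cost_mulTv y : cost_le (mulTv (sparse_of A) y) (2 * Z + n).
Proof.
apply: cost_leW; first by apply: cost_vec => i; exact: cost_sdot.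
by rewrite big_split /= -big_distrr /= nnz_cols sum_nat_const card_ord muln1.
Qed.

Lemma cost_norm2inf : cost_le (norm2inf (sparse_of A)) (2 * Z + 3 * m + 1).
Proof.
apply: (@cost_leW _ _ _ ((2 * Z + m * 2) + m.+1)); last by lia.
apply: cost_bind => [|r]; last exact: cost_pmaxs_entries.
apply: cost_leW; first by apply: cost_vec => i; exact: cost_snorm2.
by rewrite big_split /= -big_distrr /= nnz_rows sum_nat_const card_ord.
Qed.

Lemma cost_outer T (alpha tau eta h w : R) s :
  cost_le (outer_step (sparse_of A) T alpha tau eta h w s)
    (8 * Z + 15 * m + 9 * n + 9 + T * (31 * m + 18 * n + 21)).
Proof.
case: s => [[x0 y0] [Sx Sy]].
apply: (@cost_leW _ _ _ ((2 * Z + n) + ((2 * Z + m) + (m * 2 + (1 +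
  (T * (31 * m + 18 * n + 21) + (1 + (n + (m + (1 + (1 + ((2 * Z + n) + (n + (n +
  ((3 * n + 4) + (m + ((2 * Z + m) + (m + (m + ((6 * m + 1) + (n + (m + 0))))))))))))))))))))));
  last by lia.
apply: cost_bind => [|g0x]; first exact: cost_mulTv.
apply: cost_bind => [|Ax0]; first exact: cost_mulv.
apply: cost_bind => [|g0y]; first exact: cost_vneg.
apply: cost_bind => // zero.
apply: cost_bind => [|r]; first by apply: cost_iterp => r; exact: cost_inner.
apply: cost_bind => // T'.
apply: cost_bind => [|hx]; first exact: cost_vdiv.
apply: cost_bind => [|hy]; first exact: cost_vdiv.
apply: cost_bind => // one; apply: cost_bind => // ialpha.
apply: cost_bind => [|ATy]; first exact: cost_mulTv.
apply: cost_bind => [|bx]; first exact: cost_vscale.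
apply: cost_bind => [|vx]; first exact: cost_vsub.
apply: cost_bind => [|x']; first exact: cost_projX.
apply: cost_bind => [|ly0]; first exact: cost_vlog.
apply: cost_bind => [|Ax]; first exact: cost_mulv.
apply: cost_bind => [|b_y]; first exact: cost_vscale.
apply: cost_bind => [|vy]; first exact: cost_vadd.
apply: cost_bind => [|y']; first exact: cost_projY.
apply: cost_bind => [|Sx']; first exact: cost_vadd.
by apply: cost_bind => [|Sy']; [exact: cost_vadd|exact: cost_ret].
Qed.

End Dense.
End Costs.

(** * The whole algorithm *)

(** As m, n >= 2 and z >= 4, additive constants are absorbed by z or m + n, and k >= 1 lets the
    setup be charged to one outer iteration: 12 z for the setup plus 26 z per iteration gives 38
    z. *)
Lemma cost_arith (m n z k t : nat) :
  (1 < m)%N -> (1 < n)%N -> (m + n <= z)%N -> (0 < k)%N ->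
  (2 * z + 4 * m + n + 24 +
     k * (8 * z + 15 * m + 9 * n + 9 + t * (31 * m + 18 * n + 21)) <=
   k * (38 * z + 37 * (m + n) * t))%N.
Proof.
move=> m1 n1 zmn k0.
have H1 : (2 * z + 4 * m + n + 24 <= k * (12 * z))%N.
  by apply: (@leq_trans (12 * z)); [lia|rewrite leq_pmull].
have H2 : (8 * z + 15 * m + 9 * n + 9 <= 26 * z)%N by lia.
have H3 : (t * (31 * m + 18 * n + 21) <= 37 * (m + n) * t)%N.
  by rewrite mulnC leq_mul2r; apply/orP; right; lia.
have H4 := leq_mul (leqnn k) (leq_add H2 H3).
apply: leq_trans (leq_add H1 H4) _; rewrite -mulnDr leq_mul2l; apply/orP; right.
by rewrite addnA leq_add2r -mulnDl.
Qed.

Section Solve.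
Context {R : realType}.

(** Positivity keeps clear of the case where [ceil_sem] replaces a negative ceiling by 0. *)
Lemma ceil_sem_bounds (x : R) : 0 < x -> x <= (ceil_sem x)%:R < x + 1.
Proof.
move=> x0; have := ceil_itv x; rewrite /ceil_sem.
have : 0 < Num.ceil x by rewrite ceil_gt0.
case: (Num.ceil x) => [k|k] // _.
by rewrite rmorphB /= ltrBlDr => /andP[-> ->].
Qed.

Context (m n : nat) (A : 'M[R]_(m, n)) (eps alpha : R).
Let L := l2inf_norm A.
Let K := ceil_sem (alpha * ln (2%:R * m%:R) / eps).
Let eta := alpha / (24%:R * L ^+ 2).
Let h := eta * alpha / 2%:R.
Let T := ceil_sem (4%:R / (eta * alpha)).
Let outer := outer_step (sparse_of A) T alpha eta^-1 eta h (1 + h)^-1.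
Let pt := @point R m n.
Let init : pt * pt := ((0, const_mx m%:R^-1), (0, 0)).

Lemma solve_tail (r : pt * pt) :
  evals (K' <~ lit K;; zx <~ vmap (fun a => pdiv a K') r.2.1;;
    zy <~ vmap (fun a => pdiv a K') r.2.2;; Ret (zx, zy))
    (K%:R^-1 *: r.2.1, K%:R^-1 *: r.2.2).
Proof.
apply: evals_bind (evals_lit _) _.
by apply: evals_bind (evals_vdiv _ _) _; apply: evals_bind (evals_vdiv _ _) _.
Qed.

Lemma expect_solve F :
  expect (solve (sparse_of A) eps alpha) F =
  expect (iterp K outer init) (fun r => F (K%:R^-1 *: r.2.1, K%:R^-1 *: r.2.2)).
Proof.
rewrite /solve /= (expect_evals _ _ (evals_norm2inf A)) /= expect_bind.
rewrite -!expr2 !div1r; congr (expect _ _); apply/funext => r.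
exact: (solve_tail r).2.
Qed.

Lemma always_solve (P : pt * pt -> Prop) (Q : pt -> Prop) :
  always (iterp K outer init) P ->
  (forall r, P r -> Q (K%:R^-1 *: r.2.1, K%:R^-1 *: r.2.2)) ->
  always (solve (sparse_of A) eps alpha) Q.
Proof.
move=> HP PQ; rewrite /solve.
do 6!apply: (always_evals (evals_lit _)).
apply: (always_evals (evals_norm2inf A)).
apply: (always_evals (evals_mul _ _)); apply: (always_evals (evals_log _)).
apply: (always_evals (evals_mul _ _)); apply: (always_evals (evals_div _ _)).
apply: (always_evals (evals_ceil _)); apply: (always_evals (evals_sqr _)).
apply: (always_evals (evals_mul _ _)); apply: (always_evals (evals_div _ _)).
apply: (always_evals (evals_div _ _)); apply: (always_evals (evals_mul _ _)).
apply: (always_evals (evals_div _ _)); apply: (always_evals (evals_ceil _)).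
apply: (always_evals (evals_div _ _)); apply: (always_evals (evals_add _ _)).
do 2!apply: (always_evals (evals_div _ _)).
rewrite !div1r; apply: (always_bind HP) => r Pr w.
by rewrite (solve_tail r).1; exact: PQ.
Qed.

Lemma cost_solve : cost_le (solve (sparse_of A) eps alpha)
  (2 * nnz A + 4 * m + n + 24 +
   K * (8 * nnz A + 15 * m + 9 * n + 9 + T * (31 * m + 18 * n + 21))).
Proof.
rewrite /solve.
apply: (@cost_leW _ _ _ (1 + (1 + (1 + (1 + (1 + (1 + ((2 * nnz A + 3 * m + 1) +
 (1 + (1 + (1 + (1 + (1 + (1 + (1 + (1 + (1 + (1 + (1 + (1 + (1 + (1 + (1 + (1 +
 (K * (8 * nnz A + 15 * m + 9 * n + 9 + T * (31 * m + 18 * n + 21)) +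
  (1 + (n + (m + 0)))))))))))))))))))))))))))); last by lia.
do 6!apply: (cost_evals (evals_lit _)) => //.
apply: (cost_evals (evals_norm2inf A)); first exact: cost_norm2inf.
apply: (cost_evals (evals_mul _ _)) => //; apply: (cost_evals (evals_log _)) => //.
apply: (cost_evals (evals_mul _ _)) => //; apply: (cost_evals (evals_div _ _)) => //.
apply: (cost_evals (evals_ceil _)) => //; apply: (cost_evals (evals_sqr _)) => //.
apply: (cost_evals (evals_mul _ _)) => //; apply: (cost_evals (evals_div _ _)) => //.
apply: (cost_evals (evals_div _ _)) => //; apply: (cost_evals (evals_mul _ _)) => //.
apply: (cost_evals (evals_div _ _)) => //; apply: (cost_evals (evals_ceil _)) => //.
apply: (cost_evals (evals_div _ _)) => //; apply: (cost_evals (evals_add _ _)) => //.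
do 2!apply: (cost_evals (evals_div _ _)) => //.
apply: cost_bind => [|r]; first by apply: cost_iterp => s; exact: cost_outer.
apply: cost_bind => // K'.
apply: cost_bind => [|zx]; first exact: cost_vdiv.
by apply: cost_bind => [|zy]; [exact: cost_vdiv|exact: cost_ret].
Qed.

Hypotheses (m_gt0 : (0 < m)%N) (nnzP : (m + n <= nnz A)%N) (eps_gt0 : 0 < eps).

(** From m + n <= nnz(A) <= m n one gets (m - 1) (n - 1) >= 1. This excludes small dimensions, where
    log(2m) could be below 1. *)
Let n_gt1 : (1 < m)%N /\ (1 < n)%N.
Proof.
have le : (nnz A <= m * n)%N.
  apply: leq_trans (max_card _) _; by rewrite card_prod !card_ord.
have := leq_trans nnzP le; have := m_gt0; nia.
Qed.

Lemma ln2_ge : 2^-1 <= ln 2 :> R.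
Proof.
rewrite -ler_expR lnK ?posrE//.
have := expR_ge1Dx (- (2^-1 : R)); rewrite expRN => H.
have e0 := expR_gt0 (2^-1 : R).
have : (1 - 2^-1) * expR (2^-1) <= 1 :> R by rewrite -ler_pdivlMr// div1r.
lra.
Qed.

Let lnm_gt1 : 1 <= ln (2%:R * m%:R) :> R.
Proof.
have m2 : (2 : R) <= m%:R by rewrite ler_nat; case: n_gt1.
rewrite lnM ?posrE ?ltr0n//.
have : ln 2 <= ln (m%:R) :> R by rewrite ler_ln ?posrE ?ltr0n.
have := ln2_ge; lra.
Qed.

Let L_gt0 : 0 < L.
Proof.
rewrite lt_neqAle l2inf_norm_ge0 andbT eq_sym; apply/eqP => L0.
have A0 i j : A i j = 0.
  apply/eqP; rewrite -sqrf_eq0 eq_le sqr_ge0 andbT.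
  have := sqn_row A i; rewrite -/L L0 expr0n; apply: le_trans.
  by rewrite (bigD1 j)//= lerDl sumr_ge0// => k _; exact: sqr_ge0.
have : nnz A = 0%N.
  by apply/eqP; rewrite cards_eq0; apply/eqP/setP => ij; rewrite !inE A0 eqxx.
by case: n_gt1 => m1 _ Z0; move: nnzP; rewrite Z0; lia.
Qed.

Hypothesis alphaP : admissible m eps alpha.

Let lnE : ln (2 * m)%:R = ln (2%:R * m%:R) :> R.
Proof. by rewrite natrM. Qed.

Let epsP : eps <= alpha * ln (2%:R * m%:R).
Proof.
by move: alphaP; rewrite /admissible lnE ler_pdivrMr// (lt_le_trans ltr01).
Qed.

Let alpha_gt0 : 0 < alpha.
Proof.
have := lt_le_trans eps_gt0 epsP; rewrite pmulr_lgt0//.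
exact: lt_le_trans lnm_gt1.
Qed.

Let eta_gt0 : 0 < eta.
Proof. by rewrite /eta divr_gt0// mulr_gt0// exprn_gt0. Qed.

Let hE : h = 12 * (eta * L) ^+ 2.
Proof. by rewrite /h /eta; field; rewrite gt_eqF. Qed.

Let alphaE : 2 * h = eta * alpha.
Proof. by rewrite /h; field. Qed.

Let ea_gt0 : 0 < eta * alpha. Proof. exact: mulr_gt0. Qed.

Let TP : 4%:R / (eta * alpha) <= T%:R < 4%:R / (eta * alpha) + 1.
Proof. by apply: ceil_sem_bounds; rewrite divr_gt0. Qed.

Let T_large : 2 <= h * T%:R.
Proof.
have /andP[+ _] := TP; rewrite ler_pdivrMr// -alphaE; lra.
Qed.

Let T_gt0 : (0 < T)%N.
Proof. by rewrite lt0n; apply/eqP => T0; move: T_large; rewrite T0; lra. Qed.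

Let x_ge1 : 1 <= alpha * ln (2%:R * m%:R) / eps.
Proof. by rewrite ler_pdivlMr// mul1r. Qed.

Let KP : alpha * ln (2%:R * m%:R) / eps <= K%:R < alpha * ln (2%:R * m%:R) / eps + 1.
Proof. by apply: ceil_sem_bounds; exact: lt_le_trans x_ge1. Qed.

Let K_gt0 : (0 < K)%N.
Proof. by rewrite -(ltr0n R); case/andP: KP => + _; apply: lt_le_trans; exact: lt_le_trans x_ge1. Qed.

Let init_interior : interior init.1.
Proof.
have mR : 0 < m%:R :> R by rewrite ltr0n.
split; first by rewrite /l2ball /= l2normE /sqn dot0l sqrtr0.
split=> [i|]; first by rewrite mxE invr_gt0.
rewrite /vsum; under eq_bigr do rewrite mxE.
by rewrite sumr_const card_ord -[_ *+ m]mulr_natr mulVf// gt_eqF.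
Qed.

(** The reason for 2m inside the logarithm: ln 2 >= 1/2 covers the Euclidean part of V from the
    centre of the ball, and ln m the entropy relative to the uniform point. *)
Lemma init_breg u : feasible u -> breg init.1 u <= ln (2%:R * m%:R).
Proof.
move=> [bu /simplexE[u0 u1]]; have mR : 0 < m%:R :> R by rewrite ltr0n.
rewrite lnM ?posrE// /breg /= subr0.
have := l2ball_sqn bu; have := ln2_ge.
suff : kl u.2 (const_mx m%:R^-1) <= ln (m%:R) by lra.
rewrite /kl dotBr (_ : vln (const_mx _) = const_mx (- ln (m%:R))); last first.
  by apply/colP => i; rewrite !mxE lnV.
rewrite dot_const u1 mulr1 opprK gerDr.
apply: sumr_le0 => i _; rewrite mxE mulr_ge0_le0// ln_le0//.
by rewrite -u1 /vsum (bigD1 i)//= lerDl sumr_ge0.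
Qed.

Lemma solve_feasible : always (solve (sparse_of A) eps alpha)
  (fun z => l2ball z.1 /\ simplex z.2).
Proof.
apply: (always_solve (P := fun r => multiple K r.2)).
  apply: always_outer_loop => //; exact: multiple0.
by move=> r mr; exact: (multiple_mean K_gt0 mr).
Qed.

Lemma solve_gap :
  (expect (solve (sparse_of A) eps alpha) (fun z => (explicit_gap A z)%:E) <= eps%:E)%E.
Proof.
rewrite expect_solve.
have KR : 0 < K%:R :> R by rewrite ltr0n.
have [|u fu|r -> le_r] := @outer_rule R m n A m_gt0 eta h alpha T eta_gt0 hE alphaE T_large
  alpha_gt0 K%:R (fun r => (explicit_gap A (K%:R^-1 *: r.2.1, K%:R^-1 *: r.2.2))%:E)
  K init (alpha * ln (2%:R * m%:R)) KR init_interior.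
- move=> r c' Hr; exists (explicit_gap A (K%:R^-1 *: r.2.1, K%:R^-1 *: r.2.2)) => //.
  apply: explicit_gap_le => // u fu; rewrite payoffZ mulrC.
  by rewrite ler_pM2r ?invr_gt0// Hr.
- rewrite /payoff /= mulmx0 dot0r dot0l subrr add0r ler_pM2l//.
  exact: init_breg.
- rewrite lee_fin; apply: (le_trans le_r); rewrite ler_pdivrMr//.
  by have /andP[+ _] := KP; rewrite ler_pdivrMr// (mulrC K%:R).
Qed.

(** Rounding is harmless: admissibility gives x >= 1, hence K < x + 1 <= 2 x, and in T < 96 L^2 /
    alpha^2 + 1 the 1 contributes m + n <= nnz(A). Here 96 = 4 * 24. *)
Lemma cost_solve_bound w :
  (cost (solve (sparse_of A) eps alpha) w)%:R <= 8000 * time_bound A eps alpha.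
Proof.
have [m1 n1] := n_gt1.
have : (cost (solve (sparse_of A) eps alpha) w <=
    K * (38 * nnz A + 37 * (m + n) * T))%N.
  apply: leq_trans (cost_solve w) _.
  exact: cost_arith.
rewrite -(ler_nat R) => /le_trans; apply.
rewrite natrM natrD !natrM /time_bound lnE.
have : (m + n)%:R <= (nnz A)%:R :> R by rewrite ler_nat.
have : 0 <= (m + n)%:R :> R by [].
move: (nnz A)%:R ((m + n)%:R) => z M M0 Mz.
have /andP[_ kx] := KP; have /andP[k0 _] := KP; have /andP[_ tx] := TP.
have t0 : 0 <= T%:R :> R by [].
move: (K%:R) (T%:R) kx k0 tx t0 => k t kx k0 tx t0.
set x := alpha * _ / eps in kx k0 *; have x1 : 1 <= x := x_ge1.
have Q : 4%:R / (eta * alpha) = 96 * (L ^+ 2 / alpha ^+ 2).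
  by rewrite /eta; field; rewrite !gt_eqF.
rewrite {}Q in tx; rewrite -[M * _ / _]mulrA -/L.
have q0 : 0 <= L ^+ 2 / alpha ^+ 2 by rewrite divr_ge0 ?sqr_ge0.
move: (L ^+ 2 / _) tx q0 => q tx q0.
have Mq : 0 <= M * q by exact: mulr_ge0.
apply: (@le_trans _ _ (k * (38 * z + 37 * M * (96 * q + 1)))).
  by apply: ler_wpM2l; [lra|rewrite lerD2l ler_wpM2l//; lra].
rewrite mulrA -[8000 * _]mulrC.
(* 75 = 38 + 37 and 3552 = 37 * 96; doubling the latter stays below 8000. *)
have : k * (38 * z + 37 * M * (96 * q + 1)) <= (2 * x) * (75 * z + 3552 * (M * q)).
  by apply: ler_pM; lra.
have : 0 <= x * (z + M * q) by apply: mulr_ge0; lra.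
have : 0 <= x * z by apply: mulr_ge0; lra.
have : 0 <= x * (M * q) by apply: mulr_ge0; lra.
lra.
Qed.

End Solve.

(** * The optimal choice of alpha *)

Section Tuning.
Context {R : realType} (m n : nat) (A : 'M[R]_(m, n)) (eps : R).
Hypotheses (m_gt0 : (0 < m)%N) (nnzP : (m + n <= nnz A)%N) (eps_gt0 : 0 < eps).
Let z : R := (nnz A)%:R.
Let L := l2inf_norm A.
Let l : R := ln (2 * m)%:R.
(** The time bound is proportional to alpha + s^2 / alpha, whose unconstrained minimiser is s = L
    sqrt((m + n) / nnz(A)). *)
Let s := Num.sqrt (z * (m + n)%:R) * L / z.
Let best := Num.max (eps / l) s.

Let z_gt0 : 0 < z.
Proof. by rewrite ltr0n; apply: leq_trans nnzP; rewrite addn_gt0 m_gt0. Qed.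

Let l_gt0 : 0 < l.
Proof. by rewrite ln_gt0// ltr1n; lia. Qed.

Let a0_gt0 : 0 < eps / l. Proof. exact: divr_gt0. Qed.

Let s_ge0 : 0 <= s.
Proof. by rewrite divr_ge0 ?mulr_ge0 ?l2inf_norm_ge0 ?sqrtr_ge0 ?ltW. Qed.

Let time_boundE a : 0 < a ->
  time_bound A eps a = z * (a + s ^+ 2 / a) * (l / eps).
Proof.
move=> a0; rewrite /time_bound -/z -/L -/l.
have -> : s ^+ 2 = (m + n)%:R * L ^+ 2 / z.
  rewrite /s !exprMn sqr_sqrtr ?mulr_ge0 ?ler0n//.
  by field; rewrite gt_eqF.
by field; rewrite !gt_eqF.
Qed.

(** The function a + s^2 / a decreases up to s and increases afterwards, so raising s to the
    admissible floor is optimal; the factorisation below expresses this without derivatives. *)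
Lemma best_optimal : optimal A eps best.
Proof.
have b0 : eps / l <= best by rewrite le_max lexx.
split=> // a aP; have ap : 0 < a := lt_le_trans a0_gt0 aP.
have bp : 0 < best := lt_le_trans a0_gt0 b0.
rewrite !time_boundE// ler_pM2r ?divr_gt0// ler_pM2l//.
rewrite -subr_ge0.
have -> : a + s ^+ 2 / a - (best + s ^+ 2 / best) =
    (a - best) * (a * best - s ^+ 2) / (a * best).
  by field; rewrite !gt_eqF.
apply: divr_ge0; last by rewrite mulr_ge0 ?ltW.
move: aP b0 bp; rewrite /admissible -/l /best.
have := s_ge0; have := a0_gt0; move: (eps / l) ap s => a0 ap t a00 t0 aP.
case: (leP a0 t) => cmp _ bp.
  have -> : (a - t) * (a * t - t ^+ 2) = t * (a - t) ^+ 2 by ring.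
  by rewrite mulr_ge0 ?sqr_ge0.
by apply: mulr_ge0; nra.
Qed.

(** At [best] the bound is at most proportional to eps / l + 2 s: the floor eps / l yields nnz(A)
    and s the square-root term. Comparison with [best] transfers this to any optimal value. *)
Lemma optimal_time a : optimal A eps a ->
  time_bound A eps a <= 2 * (z + Num.sqrt (z * (m + n)%:R) * L * l / eps).
Proof.
move=> [_ /(_ best best_optimal.1)] /le_trans; apply.
have b0 : eps / l <= best by rewrite le_max lexx.
have bp : 0 < best := lt_le_trans a0_gt0 b0.
rewrite time_boundE//.
have -> : z + Num.sqrt (z * (m + n)%:R) * L * l / eps =
    z * (eps / l + s) * (l / eps).
  by rewrite /s; field; rewrite !gt_eqF.
rewrite [leRHS]mulrA ler_pM2r ?divr_gt0// [leRHS]mulrCA ler_pM2l//.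
have sb : s ^+ 2 / best <= s.
  by rewrite ler_pdivrMr// expr2 ler_wpM2l// le_max lexx orbT.
have : best <= eps / l + s by rewrite ge_max lerDl lerDr s_ge0 ltW.
have := a0_gt0; lra.
Qed.

End Tuning.

Theorem theorem2 (R : realType) :
  exists C : R, 0 < C /\
  forall (m n : nat) (A : 'M[R]_(m, n)) (eps : R),
    (0 < m)%N -> (m + n <= nnz A)%N -> 0 < eps ->
  [/\ forall alpha : R, admissible m eps alpha ->
        let alg := solve (sparse_of A) eps alpha in
        [/\ forall w, random_stream w ->
              l2ball (output alg w).1 /\
              simplex (output alg w).2,
            expect alg (fun z => (duality_gap A z)%:E) =
              expect alg (fun z => (explicit_gap A z)%:E),
            (expect alg (fun z => (explicit_gap A z)%:E) <= eps%:E)%E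
          & forall w, random_stream w ->
              (cost alg w)%:R <= C * time_bound A eps alpha],
      exists alpha : R, optimal A eps alpha
    & forall alpha : R, optimal A eps alpha ->
        forall w, random_stream w ->
          (cost (solve (sparse_of A) eps alpha) w)%:R <=
          C * ((nnz A)%:R +
               Num.sqrt ((nnz A)%:R * (m + n)%:R) * l2inf_norm A
               * ln (2 * m)%:R / eps)].
Proof.
(* Twice the 8000 of [cost_solve_bound], the factor 2 coming from [optimal_time]. In the first bound
   the larger constant is admissible because the time bound dominates a nonnegative cost. *)
exists 16000; split; first by rewrite ltr0n.
move=> m n A eps m0 Zmn eps0; split.
- move=> alpha alphaP alg.
  have cb w := cost_solve_bound m0 Zmn eps0 alphaP w.
  split=> [w _||| w _].
  + exact: solve_feasible.
  + by congr (expect _ _); apply/funext => z; rewrite duality_gapE.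
  + exact: solve_gap.
  + apply: le_trans (cb w) _; have := le_trans _ (cb w).
    move/(_ 0); rewrite ler0n => /(_ isT); lra.
- by exists (Num.max (eps / ln (2 * m)%:R)
    (Num.sqrt ((nnz A)%:R * (m + n)%:R) * l2inf_norm A / (nnz A)%:R));
    exact: best_optimal.
- move=> alpha opt w _.
  apply: le_trans (cost_solve_bound m0 Zmn eps0 opt.1 w) _.
  have := optimal_time m0 Zmn eps0 opt; lra.
Qed.
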